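(* For the scenario set $\mathcal{U}^I$, the recoverable robust spanning tree problem \textsc{Rob Rec ST} is solvable in $O((n-1-k)m^2n)$ time.
   Context: Let $G=(V,E)$ be a connected undirected graph with $|V|=n$, $|E|=m$, and $\Phi$ its set of spanning trees (as edge sets). Each edge $e$ has a first stage cost $C_e$, a nominal second stage cost $c_e$ and a deviation $d_e\ge0$. For $X\in\Phi$ and integer $k\in[0,n-1]$, $\Phi^k_X=\{Y\in\Phi:|Y\setminus X|\le k\}$. The scenario set is $\mathcal{U}^I=\{S=(c^S_e)_{e\in E}: c^S_e\in[c_e,c_e+d_e],\ e\in E\}$. \textsc{Rob Rec ST} asks for $X\in\Phi$ minimizing $\sum_{e\in X}C_e+\max_{S\in\mathcal{U}}\min_{Y\in\Phi^k_X}\sum_{e\in Y}c^S_e$ with $\mathcal{U}=\mathcal{U}^I$.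
   Formalization: The time bound is read as max(1, max(1, n-1-k) m^2 n) on a unit-cost RAM: for k = n-1 the stated bound (n-1-k)m^2 n is 0, which no algorithm can meet; for k < n-1 the bound is exactly as stated. *)

(* Defs.v *)
From HB Require Import structures.
From mathcomp Require Import all_boot all_order all_algebra.
From mathcomp Require Import classical_sets.
Set Implicit Arguments. Unset Strict Implicit. Unset Printing Implicit Defensive.
Import Order.TTheory GRing.Theory Num.Theory.
Local Open Scope classical_set_scope.
Local Open Scope ring_scope.

(* Vertices are 'I_n and edges 'I_m; G e lists the two ends of e in an
   arbitrary order. Loops and parallel edges are not excluded. *)
Definition graph (n m : nat) := 'I_m -> 'I_n * 'I_n.

Definition joins n m (G : graph n m) (e : 'I_m) (u v : 'I_n) : bool :=
  (G e == (u, v)) || (G e == (v, u)).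

Definition adjacent n m (G : graph n m) (X : {set 'I_m}) : rel 'I_n :=
  fun u v => [exists e in X, joins G e u v].

Definition connected_by n m (G : graph n m) (X : {set 'I_m}) : Prop :=
  forall u v : 'I_n, connect (adjacent G X) u v.

Definition connected_graph n m (G : graph n m) : Prop :=
  connected_by G [set: 'I_m]%SET.

(* A closed walk is a list of pairs (e, v): traverse e, arriving at v. It is a
   cycle of (V, X) if it repeats no edge and no vertex. A loop is a cycle of
   length 1, two parallel edges form one of length 2. *)
Definition is_cycle n m (G : graph n m) (X : {set 'I_m})
    (s : seq ('I_m * 'I_n)) : bool :=
  [&& s != [::],
      cycle (fun p q => joins G q.1 p.2 q.2) s,
      uniq (unzip1 s), uniq (unzip2 s) & all (mem X) (unzip1 s)].

Definition acyclic n m (G : graph n m) (X : {set 'I_m}) : Prop :=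
  forall s, ~~ is_cycle G X s.

Definition spanning_tree n m (G : graph n m) (X : {set 'I_m}) : Prop :=
  connected_by G X /\ acyclic G X.

Definition is_min (R : realFieldType) (A : set R) (v : R) : Prop :=
  A v /\ lbound A v.

Definition is_max (R : realFieldType) (A : set R) (v : R) : Prop :=
  A v /\ ubound A v.

Definition total (R : realFieldType) m (w : 'I_m -> R) (X : {set 'I_m}) : R :=
  \sum_(e in X) w e.

Definition recovery_set n m (G : graph n m) (k : nat) (X : {set 'I_m}) :
    set {set 'I_m} :=
  [set Y | spanning_tree G Y /\ (#|Y :\: X| <= k)%N].

Definition interval_scenarios (R : realFieldType) m (c d : 'I_m -> R) :
    set ('I_m -> R) :=
  [set S | forall e, c e <= S e <= c e + d e].

(* z is C(X) + max_{S in U} min_{Y in Phi^k_X} S(Y). *)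
Definition robust_cost (R : realFieldType) n m (G : graph n m) (k : nat)
    (C : 'I_m -> R) (U : set ('I_m -> R)) (X : {set 'I_m}) (z : R) : Prop :=
  exists2 w,
    is_max [set v | exists2 S, U S &
                    is_min [set total S Y | Y in recovery_set G k X] v] w
    & z = total C X + w.

Definition rob_rec_ST_solution (R : realFieldType) n m (G : graph n m)
    (k : nat) (C : 'I_m -> R) (U : set ('I_m -> R)) (X : {set 'I_m}) : Prop :=
  spanning_tree G X /\
  exists2 z, robust_cost G k C U X z
    & forall X', spanning_tree G X' ->
        exists2 z', robust_cost G k C U X' z' & z <= z'.

(* Model of computation: a unit-cost RAM over the ordered field R, with
   structured control flow. The memory consists of arrays 0, 1, ... of natural
   numbers and of arrays 0, 1, ... of scalars. A program names finitely many
   arrays, but indices are computed (indirect addressing). Each read, write,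
   addition, subtraction and comparison costs one step; the subtraction of
   natural numbers is truncated. As usual for unit cost there is no
   multiplication, and scalars cannot be rounded or converted to integers. *)
Inductive nexp :=
| NConst of nat
| NRead of nat & nexp
| NAdd of nexp & nexp
| NSub of nexp & nexp.

Inductive rexp :=
| RZero
| RRead of nat & nexp
| RAdd of rexp & rexp
| RSub of rexp & rexp.

Inductive bexp :=
| BLeN of nexp & nexp
| BLeR of rexp & rexp
| BNot of bexp
| BAnd of bexp & bexp.

(* NWrite a i x stores x in cell i of integer array a; RWrite likewise for
   scalars. *)
Inductive cmd :=
| Skip
| NWrite of nat & nexp & nexp
| RWrite of nat & nexp & rexp
| Seq of cmd & cmd
| If of bexp & cmd & cmd
| While of bexp & cmd.

Record state (R : realFieldType) := State {
  nmem : nat -> nat -> nat;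
  rmem : nat -> nat -> R }.

Fixpoint neval (R : realFieldType) (s : state R) (x : nexp) : nat :=
  match x with
  | NConst j => j
  | NRead a i => nmem s a (neval s i)
  | NAdd x y => neval s x + neval s y
  | NSub x y => neval s x - neval s y
  end%N.

Fixpoint reval (R : realFieldType) (s : state R) (x : rexp) : R :=
  match x with
  | RZero => 0
  | RRead a i => rmem s a (neval s i)
  | RAdd x y => reval s x + reval s y
  | RSub x y => reval s x - reval s y
  end.

Fixpoint beval (R : realFieldType) (s : state R) (b : bexp) : bool :=
  match b with
  | BLeN x y => (neval s x <= neval s y)%N
  | BLeR x y => reval s x <= reval s y
  | BNot b => ~~ beval s b
  | BAnd b b' => beval s b && beval s b'
  end.

Fixpoint ncost (x : nexp) : nat :=
  match x with
  | NConst _ => 1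
  | NRead _ i => (ncost i).+1
  | NAdd x y | NSub x y => (ncost x + ncost y).+1
  end%N.

Fixpoint rcost (x : rexp) : nat :=
  match x with
  | RZero => 1
  | RRead _ i => (ncost i).+1
  | RAdd x y | RSub x y => (rcost x + rcost y).+1
  end%N.

Fixpoint bcost (b : bexp) : nat :=
  match b with
  | BLeN x y => (ncost x + ncost y).+1
  | BLeR x y => (rcost x + rcost y).+1
  | BNot b => (bcost b).+1
  | BAnd b b' => (bcost b + bcost b').+1
  end%N.

Definition update (T : Type) (f : nat -> nat -> T) (a i : nat) (v : T) :
    nat -> nat -> T :=
  fun a' i' => if (a' == a) && (i' == i) then v else f a' i'.

(* exec p s t s' : started in state s, p halts in state s' after t steps. *)
Inductive exec (R : realFieldType) :
    cmd -> state R -> nat -> state R -> Prop :=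
| ExecSkip s : exec Skip s 1 s
| ExecNWrite a i x s :
    exec (NWrite a i x) s (ncost i + ncost x).+1
      (State (update (nmem s) a (neval s i) (neval s x)) (rmem s))
| ExecRWrite a i x s :
    exec (RWrite a i x) s (ncost i + rcost x).+1
      (State (nmem s) (update (rmem s) a (neval s i) (reval s x)))
| ExecSeq p q s t s' t' s'' :
    exec p s t s' -> exec q s' t' s'' -> exec (Seq p q) s (t + t')%N s''
| ExecIfTrue b p q s t s' :
    beval s b -> exec p s t s' -> exec (If b p q) s (bcost b + t).+1 s'
| ExecIfFalse b p q s t s' :
    ~~ beval s b -> exec q s t s' -> exec (If b p q) s (bcost b + t).+1 s'
| ExecWhileTrue b p s t s' t' s'' :
    beval s b -> exec p s t s' -> exec (While b p) s' t' s'' ->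
    exec (While b p) s (bcost b + t + t').+1 s''
| ExecWhileFalse b p s :
    ~~ beval s b -> exec (While b p) s (bcost b).+1 s.

Definition tabulate (T : Type) (x0 : T) m (f : 'I_m -> T) (i : nat) : T :=
  oapp f x0 (insub i).

(* Integer array 0 holds n, m, k; integer arrays 1 and 2 hold the ends of the
   edges; scalar arrays 0, 1, 2 hold C, c, d. All other cells are 0. *)
Definition input (R : realFieldType) n m (G : graph n m) (k : nat)
    (C c d : 'I_m -> R) : state R :=
  State
    (fun a => match a with
     | 0 => nth 0 [:: n; m; k]
     | 1 => tabulate 0 (fun e => nat_of_ord (G e).1)
     | 2 => tabulate 0 (fun e => nat_of_ord (G e).2)
     | _ => fun=> 0
     end)%N
    (fun a => match a with
     | 0%N => tabulate 0 C
     | 1%N => tabulate 0 c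
     | 2%N => tabulate 0 d
     | _ => fun=> 0
     end).

(* The result is read off integer array 3, as a characteristic vector. *)
Definition output (R : realFieldType) m (s : state R) : {set 'I_m} :=
  [set e : 'I_m | nmem s 3 e != 0%N]%SET.

(* The product (n - 1 - k) m^2 n vanishes for k = n - 1, where no algorithm can
   run in 0 steps, and m^2 n vanishes for the one-vertex graph without edges.
   The maxima affect only these cases: for a connected graph and k < n - 1 the
   value is exactly (n - 1 - k) m^2 n. *)
Definition time_bound (n m k : nat) : nat :=
  maxn 1 (maxn 1 (n - 1 - k) * m ^ 2 * n)%N.

(* Main.v *)
(** Only the scenario [w = c + d] matters, so one minimises [C X + w Y] over
    pairs of spanning trees with [#|Y :\: X| <= k]. Starting from two minimum
    spanning trees, each phase lowers [#|Y :\: X|] by one, as in weighted matroid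
    intersection. Optimality is certified by a splitting of a Lagrange multiplier
    [lam] of the cardinality constraint: [0 <= p <= lam], [X] is minimum for
    [C - p], [Y] is minimum for [w + p], [p = 0] on [X :\: Y] and [p = lam] on
    [Y :\: X]. In a phase, a Dijkstra search over the exchange arcs leads from
    [Y :\: X] to [X :\: Y] and raises [p] on the explored edges so that the arcs of
    the search tree become tight. As every edge gets the earliest explored
    tight predecessor as its parent, the path found has no tight shortcut, so the
    exchanges along it can be made simultaneously, and they preserve both
    minimality conditions. A phase costs O(m^2 n), for the fundamental cuts of both
    trees, and there are at most n - 1 - k phases. *)
From mathcomp Require Import all_boot all_order all_algebra.
From mathcomp Require Import classical_sets.
From mathcomp Require Import fintype finset.
From mathcomp Require Import zify ring lra.
(* [Defs] comes last so that [total] is not shadowed by [ssrbool.total]. *)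
Require Import Defs.
Import Order.TTheory GRing.Theory Num.Theory.
Local Open Scope ring_scope.
Set Implicit Arguments. Unset Strict Implicit. Unset Printing Implicit Defensive.

(** * Spanning trees and exchanges *)

(** A certificate works by complementary slackness: [C X + w Y] is [(C - p) X + (w + p) Y] plus
    [p X - p Y], and this difference is [- lam * #|Y :\: X|] for the certified pair and at least
    [- lam * #|Y' :\: X'|] for a competitor. This needs [lam = 0] or [#|Y :\: X| = k], which holds
    in the end because a phase runs only while the difference exceeds [k].

    The obstacle is that exchanges that are valid one by one need not be valid together, since each
    changes the cuts used by the others. They are compatible if some order is triangular: no
    entering edge crosses the cut, in the original tree, of an edge that left earlier. Absence of
    tight shortcuts provides such an order.

    The running time is read off the program text. Loops never exit early but run for a number of
    rounds fixed by the input, idling when done, so loop nesting alone gives the bound. The factor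
    [m^2 n] comes from marking cuts, which for each edge takes [n] sweeps over all edges; a search
    costs only O(m^2), as distances are updated and not recomputed. *)

Section Connectivity.
Variables (n m : nat) (G : graph n m).
Implicit Types (X T : {set 'I_m}) (e f : 'I_m) (u v : 'I_n).

Notation cn X := (connect (adjacent G X)).
Notation src e := (G e).1.
Notation dst e := (G e).2.

Lemma joins_sym e u v : joins G e u v = joins G e v u.
Proof. by rewrite /joins orbC. Qed.

Lemma adjacent_sym X : symmetric (adjacent G X).
Proof. by move=> u v; apply: eq_existsb => e; rewrite joins_sym. Qed.

Lemma cn_sym X u v : cn X u v = cn X v u.
Proof. exact: (sym_connect_sym (@adjacent_sym X)). Qed.

Lemma cn_trans X : transitive (cn X).
Proof. exact: connect_trans. Qed.

Lemma cn_edge X e : e \in X -> cn X (src e) (dst e).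
Proof.
move=> eX; apply/connect1/existsP; exists e.
by rewrite eX /joins; case: (G e) => a b; rewrite eqxx.
Qed.

Lemma joins_cases e u v : joins G e u v ->
  (u = src e /\ v = dst e) \/ (u = dst e /\ v = src e).
Proof. by rewrite /joins; case/orP => /eqP ->; [left|right]. Qed.

Lemma cn_joins X e u v : e \in X -> joins G e u v -> cn X u v.
Proof. by move=> /cn_edge H /joins_cases[[-> ->]|[-> ->]] //; rewrite cn_sym. Qed.

Lemma cn_sub X T u v : X \subset T -> cn X u v -> cn T u v.
Proof.
move=> sXT; apply: connect_sub => {}u {}v /existsP[e /andP[eX]].
by apply: cn_joins; apply: (subsetP sXT).
Qed.

(** Traversing [f] twice is never useful, so a path uses it not at all or once, in one of two
    directions. Statements about adding or removing an edge thus become Boolean combinations of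
    connections in the smaller set. *)
Lemma cn_setU1 f X u v :
  cn (f |: X) u v = [|| cn X u v, cn X u (src f) && cn X (dst f) v
                     | cn X u (dst f) && cn X (src f) v].
Proof.
have sX : X \subset f |: X by apply: subsetUr.
have Hf : cn (f |: X) (src f) (dst f) by apply: cn_edge; rewrite setU11.
apply/idP/idP; last first.
  case/or3P => [/(cn_sub sX) //|/andP[/(cn_sub sX) a /(cn_sub sX) b]|
                 /andP[/(cn_sub sX) a /(cn_sub sX) b]].
    exact: cn_trans (cn_trans a Hf) b.
  by rewrite cn_sym in Hf; exact: cn_trans (cn_trans a Hf) b.
case/connectP => p; elim: p u => [u _ ->|x p IH u /= /andP[ux xp] vE].
  by rewrite connect0.
have {}IH := IH _ xp vE.
case/existsP: ux => g /andP[gX gj].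
case: (eqVneq g f) gj gX => [-> gj _|gf gj].
  apply/or3P; case: (joins_cases gj) IH => [[-> ->]|[-> ->]] /or3P[H|/andP[H1 H2]|/andP[H1 H2]];
    rewrite ?connect0 ?H ?H2 /=; by [constructor 1|constructor 2|constructor 3].
rewrite in_setU1 (negPf gf) /= => gX.
have ux := cn_joins gX gj.
apply/or3P; case/or3P: IH => [H|/andP[H1 H2]|/andP[H1 H2]].
- by constructor 1; apply: cn_trans H.
- by constructor 2; rewrite H2 andbT; apply: cn_trans H1.
- by constructor 3; rewrite H2 andbT; apply: cn_trans H1.
Qed.

End Connectivity.

(** For a tree [X] with [e \in X]: [f] joins the two sides of the fundamental cut of [e];
    equivalently, [e] lies on the tree path between the ends of [f]. For [f = e] it says that [e] is
    a bridge of [X]. *)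
Definition crosses n m (G : graph n m) (X : {set 'I_m}) (e f : 'I_m) : bool :=
  ~~ connect (adjacent G (X :\ e)) (G f).1 (G f).2.

Section SpanningTrees.
Variables (n m : nat) (G : graph n m).
Implicit Types (X T Z : {set 'I_m}) (e f g : 'I_m) (u v : 'I_n).

Notation cn X := (connect (adjacent G X)).
Notation src e := (G e).1.
Notation dst e := (G e).2.

Lemma joins_ends e : joins G e (src e) (dst e).
Proof. by rewrite /joins -surjective_pairing eqxx. Qed.

Lemma cn_setU1_joins f X u v x y : joins G f u v ->
  cn (f |: X) x y = [|| cn X x y, cn X x u && cn X v y | cn X x v && cn X u y].
Proof.
move=> j; rewrite cn_setU1; case: (joins_cases j) => [[-> ->]|[-> ->]] //.
by rewrite [X in _ || X]orbC.
Qed.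

Lemma cn_setU1_id f X u v : cn X (src f) (dst f) -> cn (f |: X) u v = cn X u v.
Proof.
move=> H; apply/idP/idP; last by apply: cn_sub; apply: subsetUr.
rewrite cn_setU1 => /or3P[//|/andP[a b]|/andP[a b]].
  exact: connect_trans (connect_trans a H) b.
by rewrite cn_sym in H; exact: connect_trans (connect_trans a H) b.
Qed.

Lemma cn_span X Z u v : (forall e, e \in Z -> cn X (src e) (dst e)) ->
  cn Z u v -> cn X u v.
Proof.
move=> H; apply: connect_sub => x y /existsP[e /andP[/H eX j]].
by case: (joins_cases j) => [[-> ->]|[-> ->]] //; rewrite cn_sym.
Qed.

Lemma cycle_bridge X s : is_cycle G X s ->
  exists2 e, e \in X & cn (X :\ e) (src e) (dst e).
Proof.
case/and5P; case: s => // [[e v] s] _ cyc /= /andP[es _] _ /andP[eX sX].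
exists e => //; move: cyc; rewrite /= rcons_path => /andP[pth j].
have {pth} : cn (X :\ e) v (last (e, v) s).2.
  move: j es sX pth => _; rewrite -[X in cn _ X]/((e, v).2).
  elim: s (e, v) => [|p s IH] q /=; first by rewrite connect0.
  rewrite inE negb_or => /andP[ne es] /andP[pX sX] /andP[jp pth].
  apply: connect_trans (IH p es sX pth).
  by apply: cn_joins jp; rewrite !inE eq_sym ne.
by case: (joins_cases j) => [[-> /= ->]|[-> /= ->]] //; rewrite cn_sym.
Qed.

(** Labels a simple path with edges, in the format of [is_cycle]. The last clause carries the
    induction: all later edges have both ends on the rest of the path, whereas the new edge has an
    end that the path has left for good, so no edge repeats. *)
Lemma simple_path_edges X (q : 'I_m * 'I_n) p :
  path (adjacent G X) q.2 p -> uniq (q.2 :: p) ->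
  exists s : seq ('I_m * 'I_n),
    [/\ unzip2 s = p, path (fun p q => joins G q.1 p.2 q.2) q s,
        uniq (unzip1 s), all (mem X) (unzip1 s) &
        all [pred e | (src e \in q.2 :: p) && (dst e \in q.2 :: p)] (unzip1 s)].
Proof.
elim: p q => [|x p IH] q; first by exists [::].
rewrite /= => /andP[/existsP[g /andP[gX j]] pth] /andP[qn un].
have [s [s2 sp su sX sv]] := IH (g, x) pth un.
exists ((g, x) :: s); split => /=; rewrite ?s2 ?j ?sp ?gX ?sX ?su ?andbT //.
  apply/negP => /(allP sv) /andP[g1 g2]; move: qn.
  by case: (joins_cases j) => [[-> _]|[-> _]]; rewrite ?g1 ?g2.
apply/andP; split.
  case: (joins_cases j) => [[<- <-]|[<- <-]]; by rewrite !inE !eqxx ?orbT.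
apply: sub_all sv => h /andP[/= h1 h2].
by rewrite in_cons h1 orbT in_cons h2 orbT.
Qed.

(** Trades cycles for bridges: a cycle connects the ends of its first edge without that edge, and a
    simple path that connects the ends of [e] without [e] closes up to a cycle. *)
Lemma acyclicP X : acyclic G X <-> forall e, e \in X -> crosses G X e e.
Proof.
split=> [ac e eX|br s]; last first.
  apply/negP => /cycle_bridge[e eX]; apply/negP; exact: br.
apply/negP => /connectP[p pth lst]; move: pth lst.
case/shortenP => p' pth un _ lst.
have [s [s2 sp su sX sv]] := simple_path_edges (q := (e, src e)) pth un.
have /negP := ac ((e, src e) :: s); apply.
have lE : last (src e) p' = (last (e, src e) s).2.
  by rewrite -s2 -[X in last X]/((e, src e).2) last_map.
have sX' g : g \in unzip1 s -> g \in X :\ e by move/(allP sX).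
apply/and5P; split=> //.
- by rewrite /cycle rcons_path sp /= -lE -lst joins_sym joins_ends.
- by rewrite /= su andbT; apply/negP => /sX'; rewrite !inE eqxx.
- by rewrite /= s2.
- rewrite /= eX; apply/allP => g /sX'; by rewrite !inE => /andP[].
Qed.

Lemma treeP X : spanning_tree G X <->
  connected_by G X /\ forall e, e \in X -> crosses G X e e.
Proof. by split=> -[c /acyclicP]. Qed.

(** Without [e] there are exactly two components, those of the ends of [e]. One side therefore
    determines the cut, and the program marks only the side of the first end. *)
Lemma cut_sides X e u v : spanning_tree G X -> e \in X ->
  cn (X :\ e) u v = (cn (X :\ e) (src e) u == cn (X :\ e) (src e) v).
Proof.
case/treeP => co br eX; have /negP ne := br e eX.
have two x : cn (X :\ e) (src e) x || cn (X :\ e) (dst e) x.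
  have := co (src e) x; rewrite -{1}(setD1K eX) cn_setU1.
  by case/or3P => [->|/andP[_ ->]|/andP[_ ->]]; rewrite ?orbT.
apply/idP/eqP => [uv|].
  by apply/idP/idP => h; [apply: connect_trans h uv|rewrite cn_sym in uv; apply: connect_trans h uv].
case: (boolP (cn _ _ v)) => hv hu; first by rewrite cn_sym in hu; apply: connect_trans hu hv.
have := two u; rewrite hu /= => du; have := two v; rewrite (negPf hv) /=.
by rewrite cn_sym in du; apply: connect_trans.
Qed.

Lemma swap X e f : spanning_tree G X -> e \in X -> crosses G X e f ->
  spanning_tree G (f |: X :\ e).
Proof.
case/treeP => co br eX cr; have nf : f \notin X :\ e.
  by apply/negP => /(@cn_edge _ _ G); apply/negP.
have sp : cn (f |: X :\ e) (src e) (dst e).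
  have := co (src f) (dst f); rewrite -{1}(setD1K eX) cn_setU1 cn_setU1.
  rewrite (negPf cr) /= => /orP[] /andP[h1 h2]; apply/or3P; [constructor 2|constructor 3].
    by rewrite cn_sym h1 cn_sym h2.
  by rewrite h2 h1.
apply/treeP; split=> [u v|g].
  apply: cn_span (co u v) => g gX; case: (eqVneq g e) => [->//|ge].
  by apply: cn_edge; rewrite !inE ge gX orbT.
rewrite !inE => /orP[/eqP->|/andP[ge gX]]; first by rewrite /crosses setU1K.
have gf : g != f by apply: contraNneq nf => <-; rewrite !inE ge gX.
have gX' : g \in X :\ e by rewrite !inE ge gX.
have -> : crosses G (f |: X :\ e) g g = ~~ cn (f |: (X :\ e) :\ g) (src g) (dst g).
  by rewrite /crosses setDUl; congr (~~ cn (_ :|: _) _ _); apply/setP => h;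
    rewrite !inE; case: (eqVneq h g) => [->|] //=; rewrite (negPf gf).
rewrite cn_setU1; apply/negP => /or3P[h|/andP[h1 h2]|/andP[h1 h2]].
- move/negP: (br g gX); apply; apply: cn_sub h; apply/subsetP => h.
  by rewrite !inE => /and3P[-> _ ->].
- move/negP: cr; apply; rewrite -(setD1K gX') cn_setU1.
  by rewrite [X in X && _]cn_sym h1 [X in true && X]cn_sym h2 orbT.
- move/negP: cr; apply; rewrite -(setD1K gX') cn_setU1.
  by rewrite h2 h1 !orbT.
Qed.

End SpanningTrees.

Section Exchange.
Variables (n m : nat) (G : graph n m).
Implicit Types (X T Z : {set 'I_m}) (e f g : 'I_m) (u v : 'I_n).

Notation cn X := (connect (adjacent G X)).
Notation src e := (G e).1.
Notation dst e := (G e).2.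

(** The tree path of [f'] avoids [e], so it survives the exchange and passes through the same edges
    afterwards. *)
Lemma crosses_swap X e f e' f' : spanning_tree G X ->
  e \in X -> crosses G X e f -> ~~ crosses G X e f' ->
  e' \in X -> e' != e ->
  crosses G (f |: X :\ e) e' f' = crosses G X e' f'.
Proof.
case/treeP => co br eX cr /negPn ncr e'X ne.
have fX : f \notin X :\ e.
  by apply/negP => /(@cn_edge _ _ G); apply/negP.
have nf : e' != f by apply: contraNneq fX => <-; rewrite !inE ne e'X.
have -> : crosses G (f |: X :\ e) e' f' =
    ~~ cn (f |: (X :\ e) :\ e') (src f') (dst f').
  by rewrite /crosses setDUl; congr (~~ cn (_ :|: _) _ _); apply/setP => h;
    rewrite !inE; case: (eqVneq h e') => [->|] //=; rewrite (negPf nf).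
have e'X' : e' \in X :\ e by rewrite !inE ne e'X.
have eX' : e \in X :\ e' by rewrite !inE eq_sym ne eX.
have DC : X :\ e :\ e' = X :\ e' :\ e by rewrite setDDl setUC -setDDl.
congr negb; apply/idP/idP => h; last first.
  apply: cn_sub (subsetUr _ _) _; apply: contraTT h => nh.
  apply/negP; rewrite -(setD1K eX') -DC cn_setU1 (negPf nh) /= => h.
  have /negP := br e eX; apply.
  case/orP: h => /andP[h1 h2].
    apply: connect_trans (_ : cn _ (src f') _).
      by rewrite cn_sym; apply: cn_sub h1; apply: subsetDl.
    apply: connect_trans ncr _; rewrite cn_sym.
    by apply: cn_sub h2; apply: subsetDl.
  rewrite cn_sym; apply: connect_trans (_ : cn _ (src f') _).
    by rewrite cn_sym; apply: cn_sub h1; apply: subsetDl.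
  apply: connect_trans ncr _; rewrite cn_sym.
  by apply: cn_sub h2; apply: subsetDl.
apply: contraTT h => nh; rewrite cn_setU1.
have nh' : ~~ cn (X :\ e :\ e') (src f') (dst f').
  apply: contraNN nh; rewrite DC; apply: cn_sub; apply: subsetDl.
rewrite (negPf nh') /=; apply/negP => h; move/negP: cr; apply.
have S x y : cn (X :\ e :\ e') x y -> cn (X :\ e) x y.
  by apply: cn_sub; apply: subsetDl.
case/orP: h => /andP[/S h1 /S h2].
  rewrite cn_sym in h1; rewrite cn_sym in h2.
  exact: connect_trans (connect_trans h1 ncr) h2.
rewrite cn_sym; rewrite cn_sym in h1; rewrite cn_sym in h2.
exact: connect_trans (connect_trans h1 ncr) h2.
Qed.

(** An inclusion-minimal subset of [X] that connects the ends of [f] serves as the tree path.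
    Dropping one of its edges disconnects these ends within the subset, and also within [X], because
    that edge is a bridge of [X]. *)
Lemma tree_path X f : spanning_tree G X ->
  exists2 Z, cn Z (src f) (dst f) & {in Z, forall e, e \in X /\ crosses G X e f}.
Proof.
case/treeP => co br.
have [Z mZ sZ] : {Z | minset (fun Z => cn Z (src f) (dst f)) Z & Z \subset X}.
  by apply: minset_exists; apply: co.
have cZ := minsetp mZ; exists Z => // e eZ.
have eX := subsetP sZ e eZ; split=> //.
have nZ : ~~ cn (Z :\ e) (src f) (dst f).
  apply/negP => h; have := minsetinf mZ h (subsetDl _ _) => /setP/(_ e).
  by rewrite !inE eqxx eZ.
have S x y : cn (Z :\ e) x y -> cn (X :\ e) x y by apply: cn_sub; apply: setSD.
apply/negP => h; have /negP := br e eX; apply.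
move: cZ; rewrite -{1}(setD1K eZ) cn_setU1 (negPf nZ) /=.
case/orP => /andP[/S h1 /S h2]; last rewrite cn_sym.
  rewrite cn_sym in h1; rewrite cn_sym in h2.
  exact: connect_trans (connect_trans h1 h) h2.
rewrite cn_sym in h1; rewrite cn_sym in h2.
exact: connect_trans (connect_trans h1 h) h2.
Qed.

(** The symmetric exchange property. The tree path of [f] in [X] must cross the cut that [f] leaves
    in [T]; an edge where it does so can be traded for [f] in both trees. *)
Lemma exchange X T f : spanning_tree G X -> spanning_tree G T ->
  f \in T -> f \notin X ->
  exists e, [/\ e \in X, e \notin T, crosses G X e f & crosses G T f e].
Proof.
move=> tX /treeP[coT brT] fT fX.
have [Z cZ pZ] := tree_path f tX.
have [e eZ eT] : exists2 e, e \in Z & crosses G T f e.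
  apply/exists_inP; apply: contraT; rewrite negb_exists_in => /forall_inP H.
  have /negP := brT f fT; case.
  by apply: cn_span cZ => e /H /negPn.
have [eX cr] := pZ e eZ; exists e; split=> //.
apply/negP => eT'; have /negP := eT; apply; apply: cn_edge.
by rewrite !inE eT' andbT; apply: contraNneq fX => <-.
Qed.

Lemma tree_sub_eq X T : spanning_tree G T -> connected_by G X -> X \subset T -> X = T.
Proof.
case/treeP => _ br co sXT; apply/eqP; rewrite eqEsubset sXT; apply/subsetP => e eT.
apply: contraT => eX; have /negP := br e eT; case.
by apply: cn_sub (co _ _); apply/subsetP => g gX; rewrite !inE (subsetP sXT) // andbT;
  apply: contraNneq eX => <-.
Qed.

Section Weights.
Variable (R : realFieldType).

Lemma total_swap (a : 'I_m -> R) X e f : e \in X -> f \notin X ->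
  total a (f |: X :\ e) = total a X - a e + a f.
Proof.
move=> eX fX; rewrite /total big_setU1 /=; last by rewrite !inE negb_and fX orbT.
by rewrite [in RHS](big_setD1 e) //=; ring.
Qed.

(** Symmetric exchange moves [T] towards [X], one edge at a time, without raising its weight: the
    entering edge lies in [X] and weighs no more than the one that leaves. *)
Lemma local_min (a : 'I_m -> R) X : spanning_tree G X ->
  (forall e f, e \in X -> f \notin X -> crosses G X e f -> a e <= a f) ->
  forall T, spanning_tree G T -> total a X <= total a T.
Proof.
move=> tX loc T; have [k] := ubnP #|T :\: X|; elim: k T => // k IH T leTk tT.
have [/eqP|[f]] := set_0Vmem (T :\: X).
  by rewrite setD_eq0 => /(tree_sub_eq tX (proj1 tT)) ->.
rewrite inE => /andP[fX fT].
have [e [eX eT cX cT]] := exchange tX tT fT fX.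
apply: le_trans (IH (e |: T :\ f) _ (swap tT fT cT)) _.
  move: leTk; rewrite (cardsD1 f) !inE fX fT /= add1n ltnS; apply: leq_ltn_trans.
  apply: subset_leq_card; apply/subsetP => g; rewrite !inE.
  by case: (eqVneq g e) => [->|] /=; rewrite ?eX // => _ /andP[-> /andP[-> ->]].
by rewrite total_swap // -addrA gerDl addrC subr_le0; apply: loc.
Qed.

Lemma global_min (a : 'I_m -> R) X e f : spanning_tree G X ->
  (forall T, spanning_tree G T -> total a X <= total a T) ->
  e \in X -> f \notin X -> crosses G X e f -> a e <= a f.
Proof.
move=> tX mn eX fX cr; have := mn _ (swap tX eX cr).
by rewrite total_swap // -addrA lerDl addrC subr_ge0.
Qed.

End Weights.

(* An edge is charged to the end that its removal separates from a root. *)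
Lemma card_tree_lt X : (0 < n)%N -> spanning_tree G X -> (#|X| < n)%N.
Proof.
move=> n0 tX; have /treeP[_ br] := tX; pose r := Ordinal n0.
pose far e := if cn (X :\ e) r (src e) then dst e else src e.
pose near e := if cn (X :\ e) r (src e) then src e else dst e.
have j e : joins G e (near e) (far e).
  by rewrite /near /far; case: ifP => _; rewrite ?joins_ends // joins_sym joins_ends.
have nfar e : e \in X -> ~~ cn (X :\ e) r (far e).
  move=> eX; rewrite /far; case: ifP => [h|->//]; apply: contraNN (br e eX) => h'.
  by rewrite cn_sym in h; apply: connect_trans h h'.
have nnear e : e \in X -> cn (X :\ e) r (near e).
  move=> eX; rewrite /near; case: ifPn => // h; move: h (br e eX).
  rewrite (cut_sides r (src e) tX eX) (cut_sides r (dst e) tX eX) connect0 /crosses.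
  by case: (cn _ _ r) => //; case: (cn _ _ _).
suff inj : {in X &, injective far}.
  rewrite -(card_in_imset inj); apply: leq_trans (_ : (#|[set: 'I_n]| <= n)%N);
    last by rewrite cardsT card_ord.
  apply: proper_card.
  rewrite properE subsetT; apply/subsetPn; exists r; rewrite ?inE //.
  by apply/imsetP => -[e eX E]; have := nfar e eX; rewrite -E connect0.
move=> e e' eX e'X fE; apply/eqP; apply: contraT => ne.
(* Suppose [e] and [e'] share the far end [v]. Over [Z], the tree without both edges, the two far
   facts say that the root reaches none of [v], [u] and [u'], whereas each near fact requires one of
   them. *)
have := (nfar e eX, nfar e' e'X, nnear e eX, nnear e' e'X, j e, j e').
rewrite -fE; set v := far e; set u := near e; set u' := near e'; set Z := X :\ e :\ e'.
have -> : X :\ e = e' |: Z by rewrite setD1K // !inE eq_sym ne.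
have -> : X :\ e' = e |: Z.
  have -> : Z = X :\ e' :\ e by rewrite /Z setDDl setUC -setDDl.
  by rewrite setD1K // !inE ne.
case=> [] [] [] [] [] + + + + ju ju'.
rewrite !(cn_setU1_joins _ _ _ ju) !(cn_setU1_joins _ _ _ ju') !connect0 !andbT.
by case: (cn Z r v) => //=; case: (cn Z r u) => //=; case: (cn Z r u').
Qed.

End Exchange.

(** * Simultaneous exchanges *)

Definition swaps m (X : {set 'I_m}) (ps : seq ('I_m * 'I_m)) : {set 'I_m} :=
  foldl (fun X p => p.1 |: X :\ p.2) X ps.

Section Swaps.
Variables (n m : nat) (G : graph n m).
Implicit Types (X : {set 'I_m}) (ps : seq ('I_m * 'I_m)).

(** No edge both enters and leaves, so the outcome is independent of the order of the exchanges.
    This permits sorting and reversing them later. *)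
Lemma in_swaps X ps x : {in ps &, forall p q, p.1 != q.2} ->
  (x \in swaps X ps) = (x \in unzip1 ps) || (x \in X) && (x \notin unzip2 ps).
Proof.
elim: ps X => [|p ps IH] X H /=; first by rewrite andbT.
rewrite IH => [|q r qs rs]; last by apply: H; rewrite inE ?qs ?rs orbT.
rewrite !inE; case: (eqVneq x p.1) => [->|_] /=; last first.
  by rewrite negb_or; case: (x == p.2); case: (x \in X); rewrite ?andbF.
apply/orP; right; apply/mapP => -[q qs E].
by have := H p q (mem_head _ _); rewrite inE qs orbT E eqxx => /(_ isT).
Qed.

(** The last premise is the triangular order: by [crosses_swap], each exchange leaves the cuts
    relevant to the later ones as they were. *)
Lemma swaps_tree X ps : spanning_tree G X -> uniq (unzip1 ps) -> uniq (unzip2 ps) ->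
  {in ps, forall p, [/\ p.1 \notin X, p.2 \in X & crosses G X p.2 p.1]} ->
  pairwise (fun p q => ~~ crosses G X p.2 q.1) ps ->
  spanning_tree G (swaps X ps).
Proof.
elim: ps X => [|[f e] ps IH] X //= tX /andP[fps ups] /andP[eps ups'] H /andP[/allP hd tl].
have [/= fX eX cr] := H (f, e) (mem_head _ _).
have K p q : p \in ps -> q \in ps ->
    crosses G (f |: X :\ e) p.2 q.1 = crosses G X p.2 q.1.
  move=> pps qps; apply: crosses_swap => //; first exact: hd.
    by have [] := H p; rewrite ?inE ?pps ?orbT.
  by apply: contraNneq eps => <-; apply: map_f.
apply: IH => //; first exact: swap.
  move=> p pps; have [|p1 p2 pc] := H p; first by rewrite inE pps orbT.
  rewrite K // pc !inE p2 (negPf p1) andbF orbF; split=> //.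
    by apply: contraNneq fps => <-; apply: map_f.
  by rewrite andbT orbC; apply/orP; left; apply: contraNneq eps => <-; apply: map_f.
by move: tl; apply: sub_in_pairwise (allss ps) => p q pps qps /=; rewrite K.
Qed.

Variables (R : realFieldType) (a : 'I_m -> R).

Lemma total_swaps X ps : uniq (unzip1 ps) -> uniq (unzip2 ps) ->
  {in ps, forall p, [/\ p.1 \notin X, p.2 \in X & a p.1 = a p.2]} ->
  total a (swaps X ps) = total a X.
Proof.
elim: ps X => [|[f e] ps IH] X //= /andP[fps ups] /andP[eps ups'] H.
have [/= fX eX afe] := H (f, e) (mem_head _ _).
rewrite IH // => [|p pps]; first by rewrite total_swap // afe subrK.
have [|p1 p2 pc] := H p; first by rewrite inE pps orbT.
rewrite !inE p2 (negPf p1) andbF orbF; split=> //.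
  by apply: contraNneq fps => <-; apply: map_f.
by rewrite andbT orbC; apply/orP; left; apply: contraNneq eps => <-; apply: map_f.
Qed.

(* The exchanges are made by decreasing weight, ties being broken by the given
   order: no exchange then alters a fundamental cycle used by a later one. *)
Lemma swaps_min_tree X ps : spanning_tree G X ->
  (forall e f, e \in X -> f \notin X -> crosses G X e f -> a e <= a f) ->
  uniq (unzip1 ps) -> uniq (unzip2 ps) ->
  {in ps, forall p, [/\ p.1 \notin X, p.2 \in X, crosses G X p.2 p.1 & a p.1 = a p.2]} ->
  pairwise (fun p q => ~~ (crosses G X p.2 q.1 && (a p.2 == a q.1))) ps ->
  spanning_tree G (swaps X ps).
Proof.
move=> tX loc u1 u2 H pw.
have ups : uniq ps by apply: map_uniq u1.
pose le1 := [rel p q : 'I_m * 'I_m | a q.1 <= a p.1].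
pose ix := [rel p q : 'I_m * 'I_m | (index p ps < index q ps)%N].
pose le2 := [rel p q | le1 p q && (le1 q p ==> ix p q)].
have le1_total : ssrbool.total le1 by move=> p q; apply: le_total.
have ixps : pairwise ix ps.
  case E : ps => [//|p0 ps']; rewrite -E; apply/(pairwiseP p0) => i j.
  by rewrite !inE /ix => hi hj ij; rewrite /= !index_uniq.
have le2_trans : transitive le2.
  move=> q p r /andP[/= pq pq'] /andP[/= qr qr']; rewrite /le2 /=.
  rewrite (le_trans qr pq) /=; apply/implyP => rp.
  have := implyP pq' (le_trans rp qr); have := implyP qr' (le_trans pq rp).
  by move=> h1 h2; apply: ltn_trans h2 h1.
(* Stability of the sort keeps pairs of equal weight in the order of [ps]. *)
have srt : pairwise le2 (sort le1 ps).
  by rewrite -sorted_pairwise //; apply: sort_pairwise_stable.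
have prm : perm_eq (sort le1 ps) ps by rewrite perm_sort.
have mm : sort le1 ps =i ps by apply: perm_mem.
have -> : swaps X ps = swaps X (sort le1 ps).
  have dj p q : p \in ps -> q \in ps -> p.1 != q.2.
    by move=> /H[p1 _ _ _] /H[_ q2 _ _]; apply: contraNneq p1 => ->.
  apply/setP => x; rewrite !in_swaps //; last by move=> p q; rewrite !mm; apply: dj.
  by rewrite /unzip1 /unzip2 !(perm_mem (perm_map _ prm)).
apply: swaps_tree => //.
- by rewrite (perm_uniq (perm_map _ prm)).
- by rewrite (perm_uniq (perm_map _ prm)).
- by move=> p; rewrite mm => /H[].
have allm : all (mem ps) (sort le1 ps) by apply/allP => p; rewrite mm.
apply: (sub_in_pairwise (r := le2)) allm srt => p q pps qps /andP[/= pq pq'].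
have [p1 p2 pc pa] := H p pps; have [q1 q2 qc qa] := H q qps.
(* Minimality of [X] and the sorting bound the weights from opposite sides, so a violating pair is a
   tie. Its members are then in the order of [ps], where the hypothesis excludes it. *)
apply/negP => cr; have le := loc _ _ p2 q1 cr.
have pqE : a p.1 = a q.1 by apply/eqP; rewrite eq_le pq pa le.
have ip : (index p ps < index q ps)%N by apply: (implyP pq'); rewrite -pqE.
have := (pairwiseP p) pw (index p ps) (index q ps).
by rewrite !inE !index_mem !nth_index // cr -pa pqE eqxx => /(_ pps qps ip).
Qed.

End Swaps.

(** * Certificates of optimality *)

Section Optimality.
Variables (R : realFieldType) (n m : nat) (G : graph n m).
Implicit Types (X Y T : {set 'I_m}) (a p C w : 'I_m -> R).

Definition min_tree a X :=
  spanning_tree G X /\ forall T, spanning_tree G T -> total a X <= total a T.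

(* [p] and [lam - p] split the multiplier [lam] of the constraint on
   [#|Y :\: X|] between the two trees. *)
Definition certificate C w X Y p (lam : R) : Prop :=
  [/\ min_tree (fun e => C e - p e) X, min_tree (fun e => w e + p e) Y &
      forall e, [/\ 0 <= p e, p e <= lam, e \in X :\: Y -> p e = 0 &
                    e \in Y :\: X -> p e = lam]].

Lemma total_diff p X Y :
  total p X - total p Y = total p (X :\: Y) - total p (Y :\: X).
Proof.
rewrite /total (big_setID Y) [X in _ - X](big_setID X) /= setIC; ring.
Qed.

Lemma totalD a p X : total (fun e => a e + p e) X = total a X + total p X.
Proof. by rewrite /total big_split. Qed.

Lemma certificate_optimal C w X Y p lam k X' Y' :
  certificate C w X Y p lam -> lam = 0 \/ #|Y :\: X| = k ->
  spanning_tree G X' -> spanning_tree G Y' -> (#|Y' :\: X'| <= k)%N ->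
  total C X + total w Y <= total C X' + total w Y'.
Proof.
case=> -[tX mX] [tY mY] hp hl tX' tY' hk.
have := mX _ tX'; have := mY _ tY'; rewrite !totalD.
have tN Z : total (fun e => - p e) Z = - total p Z by rewrite /total sumrN.
rewrite !tN => h1 h2.
(* The sign of [lam] is known only through an edge, by [0 <= p e] and [p e <= lam]. *)
have lam0 : 0 <= lam \/ Y' :\: X' = finset.set0.
  case: (set_0Vmem (Y' :\: X')) => [->|[e _]]; first by right.
  by left; case: (hp e) => h3 h4 _ _; apply: le_trans h3 h4.
have dXY : total p X - total p Y = - (lam *+ #|Y :\: X|).
  rewrite total_diff /total [X in X - _]big1 ?sub0r; last by move=> e he; case: (hp e) => _ _ ->.
  congr (- _); rewrite -sumr_const; apply: eq_bigr => e he; by case: (hp e) => _ _ _ ->.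
have dXY' : - (lam *+ #|Y' :\: X'|) <= total p X' - total p Y'.
  rewrite total_diff /total -sumr_const.
  have : 0 <= \sum_(e in X' :\: Y') p e by apply: sumr_ge0 => e _; case: (hp e).
  have : \sum_(e in Y' :\: X') p e <= \sum_(e in Y' :\: X') lam.
    by apply: ler_sum => e _; case: (hp e).
  lra.
have : lam *+ #|Y' :\: X'| <= lam *+ #|Y :\: X|.
  case: lam0 => [lam0|->]; last first.
    case: hl => [->|_]; rewrite ?mul0rn // cards0 mulr0n.
    case: (set_0Vmem (Y :\: X)) => [->|[e _]]; first by rewrite cards0.
    by apply: mulrn_wge0; case: (hp e) => h3 h4 _ _; apply: le_trans h3 h4.
  by case: hl => [->|->]; rewrite ?mul0rn // ler_wpMn2l.
lra.
Qed.

Variable (k : nat) (c d C : 'I_m -> R).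
Hypothesis d_ge0 : forall e, 0 <= d e.
Let w e := c e + d e.

(** [Y] is a feasible recovery under every scenario [S], and [S] is at most [w] edge by edge; hence
    each inner minimum is at most [total w Y], and the scenario [w] attains this value. *)
Lemma robust_cost_interval X Y : spanning_tree G Y -> (#|Y :\: X| <= k)%N ->
  (forall Y', spanning_tree G Y' -> (#|Y' :\: X| <= k)%N -> total w Y <= total w Y') ->
  robust_cost G k C (interval_scenarios c d) X (total C X + total w Y).
Proof.
move=> tY kY mn; exists (total w Y) => //; split.
  exists w.
    by move=> e; rewrite lexx andbT lerDl d_ge0.
  by split=> [|v [Y' [tY' kY'] <-]]; [exists Y | exact: mn].
move=> v [S US [_ /(_ (total S Y))]] le; apply: le_trans (le _) _.
  by exists Y.
by apply: ler_sum => e _; case/andP: (US e).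
Qed.

Lemma best_recovery X : spanning_tree G X ->
  exists Y, [/\ spanning_tree G Y, (#|Y :\: X| <= k)%N &
    forall Y', spanning_tree G Y' -> (#|Y' :\: X| <= k)%N -> total w Y <= total w Y'].
Proof.
move=> tX.
pose P Y := (boolp.asbool (spanning_tree G Y)) && (#|Y :\: X| <= k)%N.
have PX : P X by rewrite /P setDv cards0 andbT; apply/boolp.asboolP.
have [Y /andP[/boolp.asboolP tY kY] mn] := arg_minP (total w) PX.
exists Y; split=> // Y' tY' kY'; apply: mn; rewrite /P kY' andbT; exact/boolp.asboolP.
Qed.

Lemma optimal_solution X Y : spanning_tree G X -> spanning_tree G Y ->
  (#|Y :\: X| <= k)%N ->
  (forall X' Y', spanning_tree G X' -> spanning_tree G Y' -> (#|Y' :\: X'| <= k)%N ->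
     total C X + total w Y <= total C X' + total w Y') ->
  rob_rec_ST_solution G k C (interval_scenarios c d) X.
Proof.
move=> tX tY kY mn; split=> //; exists (total C X + total w Y).
  apply: robust_cost_interval => // Y' tY' kY'.
  by have := mn X Y' tX tY' kY'; rewrite lerD2l.
move=> X' tX'; have [Y' [tY' kY' mn']] := best_recovery tX'.
by exists (total C X' + total w Y'); [exact: robust_cost_interval | exact: mn].
Qed.

End Optimality.

(** * The search for an exchange path *)

Section Growth.
Variables (R : realFieldType) (n m : nat) (G : graph n m).
Variables (X Y : {set 'I_m}) (C w : 'I_m -> R).
Implicit Types (p key : 'I_m -> R) (u v x : 'I_m) (Q : seq 'I_m) (t : nat).

(* A type 0 arc lets [u] enter [X] in place of [v]; a type 1 arc lets [v] enter
   [Y] in place of [u]. The type 2 marks a source of the search, which has no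
   incoming arc. *)
Definition arc t u v : bool :=
  match t with
  | 0 => [&& v \in X, u \notin X & crosses G X v u]
  | 1 => [&& u \in Y, v \notin Y & crosses G Y u v]
  | _ => false
  end.

(** The amount by which the exchange raises the weight of [X] under [C - p], or of [Y] under
    [w + p]. Both types share the term [p v - p u], so raising [p] uniformly on a set lowers the
    slack of exactly the arcs that leave it. *)
Definition slack p t u v : R :=
  p v - p u + (if t == 0%N then C u - C v else w v - w u).

Arguments arc : simpl never.
Arguments slack : simpl never.

(* The third fields say that [u0] is the earliest explored tight predecessor. *)
Record settled p Q (u0 : 'I_m) t0 x : Prop := Settled {
  settled_source : x \in Y :\: X -> t0 = 2%N;
  settled_arc : x \notin Y :\: X ->
    [/\ (t0 < 2)%N, u0 \in Q, (index u0 Q < index x Q)%N, arc t0 u0 x & slack p t0 u0 x = 0];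
  settled_first : forall u t, x \notin Y :\: X -> u \in Q -> (index u Q < index u0 Q)%N ->
    arc t u x -> 0 < slack p t u x }.

(** The Dijkstra label of an edge outside [Q]: for an [x] that is not a source, [q] is the least
    slack of an arc from [Q] to [x], and the strict inequality of the third field makes [u0] the
    earliest explored tail that attains it. A source has distance 0 from the start. *)
Record tentative p Q (h : bool) (q : R) (u0 : 'I_m) t0 x : Prop := Tentative {
  tentative_source : x \in Y :\: X -> [/\ h, t0 = 2%N & q = 0];
  tentative_arc : h -> x \notin Y :\: X ->
    [/\ (t0 < 2)%N, u0 \in Q, arc t0 u0 x & q = slack p t0 u0 x];
  tentative_first : forall u t, h -> x \notin Y :\: X -> u \in Q ->
    (index u Q < index u0 Q)%N -> arc t u x -> q < slack p t u x;
  tentative_min : forall u t, u \in Q -> arc t u x -> h /\ q <= slack p t u x }.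

Lemma slack_ge0 p lam t u x : certificate G C w X Y p lam -> arc t u x -> 0 <= slack p t u x.
Proof.
case=> -[tX mX] [tY mY] _; case: t => [|[|//]] /and3P[h1 h2 h3]; rewrite /slack /=.
  by have := global_min tX mX h1 h2 h3; lra.
by have := global_min tY mY h1 h2 h3; lra.
Qed.

Lemma slack_certificate p lam :
  spanning_tree G X -> spanning_tree G Y ->
  (forall t u x, arc t u x -> 0 <= slack p t u x) ->
  (forall e, [/\ 0 <= p e, p e <= lam, e \in X :\: Y -> p e = 0 &
                 e \in Y :\: X -> p e = lam]) ->
  certificate G C w X Y p lam.
Proof.
move=> tX tY sl hp; split=> //; split=> //; apply: local_min => // e f he hf cr.
  by have := sl 0 f e; rewrite /arc he hf cr /slack /= => /(_ isT); lra.
by have := sl 1 e f; rewrite /arc he hf cr /slack /= => /(_ isT); lra.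
Qed.

Variables (has : 'I_m -> bool) (par : 'I_m -> 'I_m) (ty : 'I_m -> nat).

Definition shifted p Q (eps : R) x : R := if x \in Q then p x + eps else p x.

Lemma key_ge0 p lam Q q x : certificate G C w X Y p lam ->
  tentative p Q (has x) q (par x) (ty x) x -> has x -> 0 <= q.
Proof.
move=> ce te hx; case: (boolP (x \in Y :\: X)) => [/(tentative_source te)[_ _ ->//]|sx].
by case: (tentative_arc te hx sx) => _ _ /(slack_ge0 ce) ? ->.
Qed.

(** The search cannot get stuck before it reaches a sink. An unexplored source is itself a
    candidate, and an explored one has, by symmetric exchange, an arc straight to an edge of
    [X :\: Y]. *)
Lemma exists_tentative p key Q f : spanning_tree G X -> spanning_tree G Y ->
  f \in Y :\: X -> {in Q, forall x, x \notin X :\: Y} ->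
  (forall x, x \notin Q -> tentative p Q (has x) (key x) (par x) (ty x) x) ->
  exists2 x, x \notin Q & has x.
Proof.
move=> tX tY fYX nsink te.
case: (boolP (f \in Q)) => [fQ|fQ]; last first.
  by exists f => //; case: (tentative_source (te f fQ) fYX).
have [fX fY] : f \notin X /\ f \in Y by move: fYX; rewrite inE => /andP[].
have [e [eX eY cr _]] := exchange tX tY fY fX.
have eQ : e \notin Q.
  by apply: contraL eX => /nsink; rewrite inE eY.
exists e => //; have /(_ f 0%N fQ) := @tentative_min _ _ _ _ _ _ _ (te e eQ).
by rewrite /arc eX fX cr => /(_ isT)[].
Qed.

Lemma index_rcons_in Q v x : x \in Q -> index x (rcons Q v) = index x Q.
Proof. by move=> xQ; rewrite -cats1 index_cat xQ. Qed.

Lemma index_rcons_new Q v : v \notin Q -> index v (rcons Q v) = size Q.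
Proof. by move=> vQ; rewrite -cats1 index_cat (negPf vQ) /= eqxx addn0. Qed.

Lemma index_rcons_lt Q v x u : v \notin Q -> u \in Q -> x \in rcons Q v ->
  (index x (rcons Q v) < index u (rcons Q v))%N ->
  x \in Q /\ (index x Q < index u Q)%N.
Proof.
move=> vQ uQ; rewrite mem_rcons inE => /orP[/eqP->|xQ]; last by rewrite !index_rcons_in.
by rewrite index_rcons_new // index_rcons_in // ltnNge ltnW // index_mem.
Qed.

(** The shift is the least distance outside [Q], so arcs that leave [Q] keep a nonnegative slack;
    arcs that enter it gain, and the others are unchanged. Sinks are outside [Q] and keep [p = 0]. A
    source still outside has distance 0, which forces a zero shift and keeps [p = lam] there. *)
Lemma shift_certificate p lam Q key v :
  spanning_tree G X -> spanning_tree G Y ->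
  certificate G C w X Y p lam ->
  {in Q, forall x, x \notin X :\: Y} ->
  (forall x, x \notin Q -> tentative p Q (has x) (key x) (par x) (ty x) x) ->
  v \notin Q -> has v -> (forall x, x \notin Q -> has x -> key v <= key x) ->
  certificate G C w X Y (shifted p Q (key v)) (lam + key v).
Proof.
move=> tX tY ce ns te vQ hv mn; have eps0 := key_ge0 ce (te v vQ) hv.
apply: slack_certificate => // [t u x ar|e].
  have := slack_ge0 ce ar; rewrite /slack /shifted.
  case: (boolP (x \in Q)) => xQ; case: (boolP (u \in Q)) => uQ; try lra.
  by have [hx] := tentative_min (te x xQ) uQ ar; have := mn x xQ hx; rewrite /slack; lra.
have [_ _ /(_ e)[p0 pl pX pY]] := ce; rewrite /shifted; split.
- by case: ifP => _ //; apply: addr_ge0.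
- by case: ifP => _; rewrite ?lerD2r // (le_trans pl) // lerDl.
- by move=> h; case: ifP => [/ns|_]; rewrite ?h //; apply: pX.
- move=> h; rewrite (pY h); case: ifPn => // eQ.
  case: (tentative_source (te e eQ) h) => he _ ke; have := mn e eQ he; lra.
Qed.

(** The shift makes the parent arc of [v] tight and leaves the slacks inside [Q] alone. As [v] goes
    to the end of the list, it precedes no parent, so earliest predecessors stay earliest. *)
Lemma shift_settled p lam Q key v :
  certificate G C w X Y p lam ->
  {in Q, forall x, settled p Q (par x) (ty x) x} ->
  (forall x, x \notin Q -> tentative p Q (has x) (key x) (par x) (ty x) x) ->
  v \notin Q -> has v ->
  {in rcons Q v, forall x, settled (shifted p Q (key v)) (rcons Q v) (par x) (ty x) x}.
Proof.
move=> ce se te vQ hv x; rewrite mem_rcons inE => /orP[/eqP->|xQ].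
  have tv := te v vQ; split.
  - by move=> h; case: (tentative_source tv h).
  - move=> h; have [t2 uQ ar ke] := tentative_arc tv hv h.
    rewrite t2 mem_rcons inE uQ orbT index_rcons_in // index_rcons_new // index_mem uQ ar.
    by split=> //; move: ke; rewrite /slack /shifted uQ (negPf vQ); lra.
  - move=> u t h uQ' lt ar; have [t2 pQ _ _] := tentative_arc tv hv h.
    have [uQ lt'] := index_rcons_lt vQ pQ uQ' lt.
    have := tentative_first tv hv h uQ lt' ar.
    by rewrite /slack /shifted uQ (negPf vQ); lra.
have sx := se x xQ; split; first exact: settled_source sx.
- move=> h; have [t2 uQ lt ar sl] := settled_arc sx h.
  rewrite t2 mem_rcons inE uQ orbT !index_rcons_in // lt ar; split=> //.
  by move: sl; rewrite /slack /shifted uQ xQ; lra.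
- move=> u t h uQ' lt ar; have [t2 pQ _ _ _] := settled_arc sx h.
  have [uQ lt'] := index_rcons_lt vQ pQ uQ' lt.
  have := settled_first sx h uQ lt' ar.
  by rewrite /slack /shifted uQ xQ; lra.
Qed.

Lemma shift_tentative p Q key eps x : x \notin Q ->
  (forall y, y \in Y :\: X -> y \notin Q -> eps = 0) ->
  tentative p Q (has x) (key x) (par x) (ty x) x ->
  tentative (shifted p Q eps) Q (has x) (key x - eps) (par x) (ty x) x.
Proof.
move=> xQ e0 tx; split.
- move=> h; have [h1 h2 h3] := tentative_source tx h.
  by split=> //; rewrite h3 (e0 x) ?subrr.
- move=> hx h; have [h1 h2 h3 h4] := tentative_arc tx hx h.
  by split=> //; rewrite h4 /slack /shifted h2 (negPf xQ); ring.
- move=> u t hx h uQ lt ar; have := tentative_first tx hx h uQ lt ar.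
  by rewrite /slack /shifted uQ (negPf xQ); lra.
- move=> u t uQ ar; have [hx] := tentative_min tx uQ ar.
  by rewrite /slack /shifted uQ (negPf xQ); split=> //; lra.
Qed.

(** The strict comparison keeps the earlier parent on a tie, as [tentative_first] requires. *)
Definition relax p v t x (st : bool * R * 'I_m * nat) :=
  let: (h, q, u, t0) := st in
  if arc t v x && (~~ h || (slack p t v x < q)) then (true, slack p t v x, v, t) else st.

Definition tent p Q x (st : bool * R * 'I_m * nat) : Prop :=
  let: (h, q, u, t0) := st in tentative p Q h q u t0 x.

Lemma relax_tentative p lam Q v x st : certificate G C w X Y p lam ->
  v \notin Q -> x != v -> tent p Q x st ->
  tent p (rcons Q v) x (relax p v 1 x (relax p v 0 x st)).
Proof.
move=> ce vQ xv; case: st => [[[h q] u0] t0] /= tx.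
have sl t := @slack_ge0 p lam t v x ce.
have inQ u : u \in Q -> u \in rcons Q v by move=> uQ; rewrite mem_rcons inE uQ orbT.
have vQ' : v \in rcons Q v by rewrite mem_rcons mem_head.
(* All outcomes of the two relaxations have one of two forms: either [v] became the parent, with a
   distance strictly below any previous one, or the label is unchanged. *)
have lift (h' : bool) q' u' t' :
    (x \in Y :\: X -> [/\ h', t' = 2%N & q' = 0]) ->
    (h' -> x \notin Y :\: X -> [/\ (t' < 2)%N, u' \in rcons Q v, arc t' u' x & q' = slack p t' u' x]) ->
    (h -> h') -> (h -> q' <= q) ->
    (forall t, arc t v x -> h' /\ q' <= slack p t v x) ->
    (u' = v /\ (h -> q' < q) \/ u' = u0 /\ [/\ h = h', q' = q & t' = t0]) ->
    tentative p (rcons Q v) h' q' u' t' x.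
  move=> src ar hh qq hv uu; split=> //.
    move=> u t h'1 hx uQ lt aru; case: uu => [[uE qlt]|[uE [hE qE tE]]].
      subst u'; have uQ2 : u \in Q.
        by move: uQ lt; rewrite mem_rcons inE => /orP[/eqP->|//]; rewrite ltnn.
      have [h1 h2] := tentative_min tx uQ2 aru.
      by apply: lt_le_trans (qlt h1) h2.
    subst; have [_ u0Q _ _] := tentative_arc tx h'1 hx.
    have [uQ2 lt2] := index_rcons_lt vQ u0Q uQ lt.
    exact: tentative_first tx _ _ h'1 hx uQ2 lt2 aru.
  move=> u t; rewrite mem_rcons inE => /orP[/eqP->|uQ] aru; first exact: hv.
  by have [h1 h2] := tentative_min tx uQ aru; rewrite hh //; split=> //; apply: le_trans h2; apply: qq.
have src0 := tentative_source tx.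
have arc0 : h -> x \notin Y :\: X -> [/\ (t0 < 2)%N, u0 \in rcons Q v, arc t0 u0 x & q = slack p t0 u0 x].
  by move=> h1 h2; case: (tentative_arc tx h1 h2) => ? /inQ.
(* A source already has distance 0, which no nonnegative slack beats. *)
have nsrc t : arc t v x -> ~~ h || (slack p t v x < q) -> x \notin Y :\: X.
  move=> /sl s0 hq; apply/negP => /src0[h1 _ q0]; move: hq; rewrite h1 q0 /=.
  by rewrite ltNge s0.
case: ifPn => [/andP[a0 c0]|n0] /=.
  have nx := nsrc 0%N a0 c0.
  case: ifPn => [/andP[a1 /= c1]|n1].
    apply: lift; rewrite ?(negPf nx) //.
    - by move=> hh; apply: ltW; apply: lt_trans c1 _; move: c0; rewrite hh.
    - move=> [|[|//]] ? //; split=> //; exact: ltW.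
    - by left; split=> // hh; apply: lt_trans c1 _; move: c0; rewrite hh.
  apply: lift; rewrite ?(negPf nx) //.
  - by move=> hh; move: c0; rewrite hh /= => /ltW.
  - move=> [|[|//]] ar //; split=> //; move: n1; rewrite ar /= -leNgt //.
  - by left; split=> // hh; move: c0; rewrite hh.
case: ifPn => [/andP[a1 c1]|n1].
  have nx := nsrc 1%N a1 c1.
  apply: lift; rewrite ?(negPf nx) //.
  - by move=> hh; move: c1; rewrite hh /= => /ltW.
  - move=> [|[|//]] ar //; split=> //.
    move: n0; rewrite ar /= negb_or negbK -leNgt => /andP[hh q0].
    by move: c1; rewrite hh /= => /ltW c1; apply: le_trans c1 q0.
  - by left; split=> // hh; move: c1; rewrite hh.
apply: lift => //; last by right.
move=> [|[|//]] ar; [move: n0|move: n1]; rewrite ar /= negb_or negbK -leNgt => /andP[] //.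
Qed.

End Growth.

(** * Exchanges along the path found *)

Lemma pairwise_rev (T : Type) (r : rel T) s :
  pairwise r (rev s) = pairwise (fun x y => r y x) s.
Proof. by elim: s => //= x s IH; rewrite rev_cons pairwise_rcons IH all_rev. Qed.

Section Augment.
Variables (R : realFieldType) (n m : nat) (G : graph n m).
Variables (X Y : {set 'I_m}) (C w p : 'I_m -> R) (lam : R).
Variables (Q : seq 'I_m) (par : 'I_m -> 'I_m) (ty : 'I_m -> nat).
Implicit Types (x y z u v : 'I_m).

(** The path is followed backwards from the sink. A source, recognised by type 2, is a fixed point,
    so iterating beyond the length of the path is harmless. *)
Definition flip (st : {set 'I_m} * {set 'I_m} * 'I_m) :=
  let: (Xc, Yc, x) := st in
  if ty x == 2%N then st
  else if ty x == 0%N then (par x |: Xc :\ x, Yc, par x)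
  else (Xc, x |: Yc :\ par x, par x).

Fixpoint trace i x : seq 'I_m :=
  if i is i'.+1 then if ty x == 2%N then [::] else x :: trace i' (par x) else [::].

Definition Xpairs s := [seq (par x, x) | x <- s & ty x == 0%N].
Definition Ypairs s := [seq (x, par x) | x <- s & ty x != 0%N].

Lemma iter_flip i Xc Yc x :
  (iter i flip (Xc, Yc, x)).1 = (swaps Xc (Xpairs (trace i x)), swaps Yc (Ypairs (trace i x))).
Proof.
have fixp k Xd Yd y : ty y = 2%N -> iter k flip (Xd, Yd, y) = (Xd, Yd, y).
  by move=> ty2; elim: k => //= k ->; rewrite /flip ty2.
elim: i Xc Yc x => [//|i IH] Xc Yc x; rewrite iterSr [trace _ _]/= [flip _]/=.
case: eqP => [ty2|_]; first by rewrite fixp.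
by rewrite /Xpairs /Ypairs /=; case: eqP => _; rewrite IH.
Qed.

Hypothesis settledQ : {in Q, forall x, settled G X Y C w p Q (par x) (ty x) x}.

Lemma settled_parent x : x \in Q -> ty x != 2%N ->
  [/\ x \notin Y :\: X, (ty x < 2)%N, par x \in Q, (index (par x) Q < index x Q)%N &
      arc G X Y (ty x) (par x) x /\ slack C w p (ty x) (par x) x = 0].
Proof.
move=> xQ tx; have sx := settledQ xQ.
have nx : x \notin Y :\: X by apply: contraNN tx => /(settled_source sx) ->.
by have [] := settled_arc sx nx.
Qed.

(** The second part is what excludes shortcuts: an entry [y] after [z] was explored no later than
    the parent of [z], so the parent of [y] was explored strictly earlier, and [settled_first]
    forbids a tight arc from it to [z]. *)
Lemma traceP i x : x \in Q ->
  [/\ {in trace i x, forall z, [/\ z \in Q, ty z != 2%N & (index z Q <= index x Q)%N]} &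
      pairwise (fun z y => index y Q <= index (par z) Q)%N (trace i x)].
Proof.
elim: i x => [|i IH] x xQ //=; case: ifPn => // tx.
have [_ _ pQ lt _] := settled_parent xQ tx; have [IH1 IH2] := IH _ pQ; split=> /=.
  move=> z; rewrite inE => /orP[/eqP->//|/IH1[zQ tz le]].
  by split=> //; apply: leq_trans le (ltnW lt).
by rewrite IH2 andbT; apply/allP => z /IH1[].
Qed.

(** The current edge acts as a temporary sink: before a source is reached, it is the only edge of
    [Xc :\: Yc] that may lie outside [X :\: Y], and [Yc :\: Xc] is still [Y :\: X]. Its own flip
    then puts it into both trees or into neither. At the end the source does the same and thereby
    leaves the difference. *)
Lemma flip_sets i (Xc Yc : {set 'I_m}) x t : t \in Q ->
  {in Q, forall z, z \in X :\: Y -> z = t} -> {in Q, forall z, (index z Q <= index t Q)%N} ->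
  x \in Q -> (index x Q < i)%N ->
  {in Q, forall z, (index z Q < index x Q)%N -> (z \in Xc) = (z \in X) /\ (z \in Yc) = (z \in Y)} ->
  (ty x != 2%N -> [/\ x \in Xc, x \notin Yc, Yc :\: Xc = Y :\: X &
                      (Xc :\: Yc) :\ x \subset X :\: Y]) ->
  (ty x = 2%N -> Yc :\: Xc = (Y :\: X) :\ x /\ Xc :\: Yc \subset X :\: Y) ->
  exists X' Y' r, [/\ iter i flip (Xc, Yc, x) = (X', Y', r), X' :\: Y' \subset X :\: Y,
    r \in Y :\: X & Y' :\: X' = (Y :\: X) :\ r].
Proof.
move=> tQ sink last; elim: i Xc Yc x => [//|i IH] Xc Yc x xQ lti below non src.
case: (eqVneq (ty x) 2%N) => [t2|t2].
  exists Xc, Yc, x; have [h1 h2] := src t2; split=> //.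
    have fixp k : iter k flip (Xc, Yc, x) = (Xc, Yc, x).
      by elim: k => //= k ->; rewrite /flip t2.
    exact: fixp.
  by apply: contraT => nx; case: (settled_arc (settledQ xQ) nx); rewrite t2.
have [nx lt2 pQ lt [ar _]] := settled_parent xQ t2; have [xX xY dYX dXY] := non t2.
have [uX uY] := below _ pQ lt.
(* [t] is the only explored sink and the last edge explored, so no parent on the path is a sink. *)
have nsink : par x \notin X :\: Y.
  apply/negP => /(sink _ pQ) pE; move: lt; rewrite pE ltnNge; by rewrite last.
have srcE : (ty (par x) == 2%N) = (par x \in Y :\: X).
  apply/idP/idP => [/eqP h|/(settled_source (settledQ pQ))->//].
  by apply: contraT => h'; case: (settled_arc (settledQ pQ) h'); rewrite h.
have xp : x != par x by apply: contraTneq lt => <-; rewrite ltnn.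
have lti' : (index (par x) Q < i)%N by apply: leq_trans lt _.
have YX z : (z \in Yc) && (z \notin Xc) = (z \in Y) && (z \notin X).
  by move/setP/(_ z): dYX; rewrite !inE => E; rewrite andbC E andbC.
have XY z : z != x -> z \in Xc -> z \notin Yc -> (z \in X) && (z \notin Y).
  by move=> zx h1 h2; have := subsetP dXY z; rewrite !inE zx h1 h2 [in X in _ -> X]andbC => /(_ isT); rewrite andbC.
rewrite iterSr /flip (negPf t2).
case t0 : (ty x) lt2 ar => [|[|//]] _ /and3P[a1 a2 _] /=.
  apply: IH => //.
  - move=> z zQ ltz; have [h1 h2] := below z zQ (ltn_trans ltz lt).
    rewrite !inE h1 h2; split=> //.
    have -> : (z == par x) = false by apply/eqP => zE; rewrite zE ltnn in ltz.
    have -> // : z != x by apply: contraTneq ltz => ->; rewrite -leqNgt ltnW.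
  - rewrite srcE => hs.
    have puY : par x \notin Y by apply: contraNN hs; rewrite inE a2.
    rewrite uY !inE eqxx puY; split=> //; [apply/setP => z | apply/subsetP => z].
      rewrite !inE; case: (eqVneq z (par x)) => [->|zp] /=; first by rewrite (negPf puY) andbF.
      case: (eqVneq z x) => [->|zx] /=; last by rewrite andbC YX andbC.
      by rewrite (negPf xY); move: nx; rewrite inE => /negPf ->.
    rewrite !inE; case: (eqVneq z (par x)) => //= zp /andP[h /andP[zx zX]].
    by rewrite andbC; apply: XY.
  - move/eqP; rewrite srcE inE => /andP[_ pY]; split.
      apply/setP => z; rewrite !inE; case: (eqVneq z (par x)) => [->|zp] //=.
      case: (eqVneq z x) => [->|zx] /=; last by rewrite andbC YX andbC.
      by rewrite (negPf xY); move: nx; rewrite inE => /negPf ->.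
    apply/subsetP => z; rewrite !inE.
    case: (eqVneq z (par x)) => [->|zp] /=; first by rewrite uY pY.
    by move=> /andP[h /andP[zx zX]]; rewrite andbC; apply: XY.
apply: IH => //.
- move=> z zQ ltz; have [h1 h2] := below z zQ (ltn_trans ltz lt).
  have zp : z != par x by apply: contraTneq ltz => ->; rewrite ltnn.
  have zx : z != x by apply: contraTneq ltz => ->; rewrite -leqNgt ltnW.
  by rewrite !inE h1 h2 (negPf zx) zp.
- rewrite srcE => hs.
  have puX : par x \in X by move: hs; rewrite inE a1 andbT negbK.
  rewrite uX !inE eqxx eq_sym (negPf xp) /= puX; split=> //; [apply/setP => z | apply/subsetP => z].
    rewrite !inE; case: (eqVneq z x) => [->|zx] /=.
      by rewrite xX; move: nx; rewrite inE => /negPf ->.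
    case: (eqVneq z (par x)) => [->|zp] /=; last by rewrite andbC YX andbC.
    by rewrite uX puX.
  rewrite !inE; case: (eqVneq z (par x)) => //= zp /andP[].
  by rewrite negb_or => /andP[zx zY] zX; rewrite andbC; apply: XY.
- move/eqP; rewrite srcE inE => /andP[pX _]; split.
    apply/setP => z; rewrite !inE; case: (eqVneq z x) => [->|zx] /=.
      by rewrite xX; move: nx; rewrite inE => /negPf ->; rewrite andbF.
    case: (eqVneq z (par x)) => [->|zp] /=; first by rewrite andbF.
    by rewrite andbC YX andbC.
  apply/subsetP => z; rewrite !inE negb_or.
  case: (eqVneq z (par x)) => [->|zp] /=; first by rewrite uX (negPf pX) andbF.
  by move=> /andP[/andP[zx zY] zX]; rewrite andbC; apply: XY.
Qed.

Hypothesis cert : certificate G C w X Y p lam.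

Lemma par_inj_trace i x : x \in Q -> uniq (trace i x) /\ uniq (map par (trace i x)).
Proof.
move=> xQ; have [inQ pw] := traceP i xQ.
elim: (trace i x) inQ pw => //= z s IH inQ /andP[/allP hd tl].
have [|u1 u2] := IH _ tl; first by move=> y ys; apply: inQ; rewrite inE ys orbT.
have [zQ tz _] := inQ z (mem_head _ _); have [_ _ _ ltz _] := settled_parent zQ tz.
rewrite u1 u2 !andbT; split.
  by apply/negP => /hd; rewrite leqNgt ltz.
apply/mapP => -[y ys E]; have [yQ ty' _] : [/\ y \in Q, ty y != 2%N & (index y Q <= index x Q)%N].
  by apply: inQ; rewrite inE ys orbT.
have [_ _ _ lty _] := settled_parent yQ ty'.
by have := hd y ys; rewrite E leqNgt lty.
Qed.

(** The arcs used are tight, so the weights do not change. In both trees the forbidden tight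
    exchange is an arc from the parent of a later trace entry [y] to an earlier entry [z]. Its head
    leaves [X] in type 0 but enters [Y] in type 1; therefore the triangular order is that of the
    trace for [X] and the reverse one for [Y]. *)
Lemma certificate_trees i x : x \in Q ->
  min_tree G (fun e => C e - p e) (swaps X (Xpairs (trace i x))) /\
  min_tree G (fun e => w e + p e) (swaps Y (Ypairs (trace i x))).
Proof.
move=> xQ; have [[tX mX] [tY mY] _] := cert.
have [u1 u2] := par_inj_trace i xQ; have [inQ pw] := traceP i xQ.
set s := trace i x in u1 u2 inQ pw *.
have first z y u t : z \in s -> y \in s -> (index y Q <= index (par z) Q)%N ->
    ty y != 2%N -> u = par y -> arc G X Y t u z -> 0 < slack C w p t u z.
  move=> zs ys le t2 -> ar; have [zQ tz _] := inQ z zs; have [yQ tyy _] := inQ y ys.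
  have [nz _ _ _ _] := settled_parent zQ tz; have [_ _ pQ lt _] := settled_parent yQ tyy.
  by apply: (settled_first (settledQ zQ) nz pQ _ ar); apply: leq_trans lt le.
have arcs z : z \in s -> arc G X Y (ty z) (par z) z /\ slack C w p (ty z) (par z) z = 0.
  by move=> zs; have [zQ tz _] := inQ z zs; case: (settled_parent zQ tz).
have sub1 f : {subset filter f s <= s} by move=> z; rewrite mem_filter => /andP[].
have uf f g : uniq (map g s) -> uniq (map g (filter f s)).
  by move=> ug; apply: subseq_uniq ug; apply: map_subseq; apply: filter_subseq.
have X1 : uniq (unzip1 (Xpairs s)) by rewrite /unzip1 -map_comp; apply: uf.
have X2 : uniq (unzip2 (Xpairs s)) by rewrite /unzip2 -map_comp map_id_in // filter_uniq.
have Y1 : uniq (unzip1 (Ypairs s)) by rewrite /unzip1 -map_comp map_id_in // filter_uniq.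
have Y2 : uniq (unzip2 (Ypairs s)) by rewrite /unzip2 -map_comp; apply: uf.
have HX : {in Xpairs s, forall q, [/\ q.1 \notin X, q.2 \in X, crosses G X q.2 q.1 &
    C q.1 - p q.1 = C q.2 - p q.2]}.
  move=> _ /mapP[z + ->] /=; rewrite mem_filter => /andP[/eqP t0 /arcs].
  by rewrite t0 /slack /= => -[/and3P[h1 h2 h3] sl]; split=> //; lra.
have HY : {in Ypairs s, forall q, [/\ q.1 \notin Y, q.2 \in Y, crosses G Y q.2 q.1 &
    w q.1 + p q.1 = w q.2 + p q.2]}.
  move=> _ /mapP[z + ->] /=; rewrite mem_filter => /andP[t0 /arcs].
  case: (ty z) t0 => [//|[|k]] _ [] // /and3P[h1 h2 h3].
  by rewrite /slack /= => sl; split=> //; lra.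
have tt2 z : z \in s -> ty z != 2%N by move=> /inQ[].
have tX' : spanning_tree G (swaps X (Xpairs s)).
  apply: (swaps_min_tree (a := fun e => C e - p e)) => //.
    by move=> e f; apply: global_min tX mX.
  rewrite pairwise_map; have := pairwise_filter (fun z => ty z == 0%N) pw.
  apply: (sub_in_pairwise (P := mem (filter (fun z => ty z == 0%N) s))); last exact: allss.
  move=> z y zs ys le /=; apply/negP => /andP[cr /eqP aE].
  have [zs' ys'] := (sub1 _ _ zs, sub1 _ _ ys).
  have [z1 _ _ _] := HX _ (map_f _ ys); have [_ z2 _ _] := HX _ (map_f _ zs).
  have := first z y (par y) 0%N zs' ys' le (tt2 _ ys') erefl.
  rewrite /arc z1 z2 cr /slack /= => /(_ isT); lra.
have tY' : spanning_tree G (swaps Y (Ypairs s)).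
  have -> : swaps Y (Ypairs s) = swaps Y (rev (Ypairs s)).
    have dj q r : q \in Ypairs s -> r \in Ypairs s -> q.1 != r.2.
      by move=> /HY[q1 _ _ _] /HY[_ r2 _ _]; apply: contraNneq q1 => ->.
    apply/setP => z; rewrite !in_swaps //; last by move=> q r; rewrite !mem_rev; apply: dj.
    by rewrite /unzip1 /unzip2 !map_rev !mem_rev.
  apply: (swaps_min_tree (a := fun e => w e + p e)) => //.
  - by move=> e f; apply: global_min tY mY.
  - by rewrite /unzip1 map_rev rev_uniq.
  - by rewrite /unzip2 map_rev rev_uniq.
  - by move=> q; rewrite mem_rev; apply: HY.
  rewrite pairwise_rev pairwise_map; have := pairwise_filter (fun z => ty z != 0%N) pw.
  apply: (sub_in_pairwise (P := mem (filter (fun z => ty z != 0%N) s))); last exact: allss.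
  move=> z y zs ys le /=; apply/negP => /andP[cr /eqP aE].
  have [zs' ys'] := (sub1 _ _ zs, sub1 _ _ ys).
  have [_ z1 _ _] := HY _ (map_f _ ys); have [z2 _ _ _] := HY _ (map_f _ zs).
  have := first z y (par y) 1%N zs' ys' le (tt2 _ ys') erefl.
  rewrite /arc z1 z2 cr /slack /= => /(_ isT); lra.
split; split=> // T tT.
  by rewrite total_swaps ?mX // => q /HX[].
by rewrite total_swaps ?mY // => q /HY[].
Qed.

Lemma certificate_augment i t : t \in Q -> t \in X :\: Y ->
  {in Q, forall z, z \in X :\: Y -> z = t} ->
  {in Q, forall z, (index z Q <= index t Q)%N} -> (size Q <= i)%N ->
  exists X' Y' r, [/\ iter i flip (X, Y, t) = (X', Y', r), certificate G C w X' Y' p lam &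
    #|Y :\: X| = #|Y' :\: X'|.+1].
Proof.
move=> tQ tXY sink last szi.
have [X' [Y' [r [E sX rYX dY]]]] : exists X' Y' r,
    [/\ iter i flip (X, Y, t) = (X', Y', r), X' :\: Y' \subset X :\: Y,
        r \in Y :\: X & Y' :\: X' = (Y :\: X) :\ r].
  have [tX tY] : t \in X /\ t \notin Y by move: tXY; rewrite inE => /andP[].
  apply: (@flip_sets i X Y t t) => //.
  - by apply: leq_trans szi; rewrite index_mem.
  - by rewrite subsetDl.
  - move=> t2; have nt : t \notin Y :\: X by rewrite inE tX.
    by have [] := settled_arc (settledQ tQ) nt; rewrite t2.
exists X', Y', r; split=> //; last by rewrite dY [LHS](cardsD1 r) rYX.
have [] := certificate_trees i tQ.
have := iter_flip i X Y t; rewrite E /= => -[<- <-] mX mY; split=> // e.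
have [_ _ /(_ e)[p0 pl pX pY]] := cert; split=> //.
  by move=> /(subsetP sX).
by rewrite dY => /setD1P[_].
Qed.

End Augment.

(** * Programs with counted loops *)

(* Straight-line programs closed under counted loops. As the loop bounds are
   read from the input parameters, which are never overwritten, such a program
   halts, and [den] gives its final state. *)
Inductive bound := Verts | Edges | Phases.

Inductive prog :=
| PSkip
| PN of nat & nexp & nexp
| PR of nat & nexp & rexp
| PSeq of prog & prog
| PIf of bexp & prog & prog
| PFor of nat & bound & prog.

Definition NV a := NRead a (NConst 0).
Definition RV a := RRead a (NConst 0).

Definition bound_exp b : nexp :=
  match b with
  | Verts => NV 0
  | Edges => NRead 0 (NConst 1)
  | Phases => NSub (NSub (NV 0) (NConst 1)) (NRead 0 (NConst 2))
  end.

Definition bound_val (g : nat -> nat) b : nat :=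
  match b with Verts => g 0 | Edges => g 1 | Phases => g 0 - 1 - g 2 end%N.

Fixpoint compile (p : prog) : cmd :=
  match p with
  | PSkip => Skip
  | PN a i x => NWrite a i x
  | PR a i x => RWrite a i x
  | PSeq p q => Seq (compile p) (compile q)
  | PIf b p q => If b (compile p) (compile q)
  | PFor i b p => Seq (NWrite i (NConst 0) (NConst 0))
      (While (BNot (BLeN (bound_exp b) (NV i)))
        (Seq (compile p) (NWrite i (NConst 0) (NAdd (NV i) (NConst 1)))))
  end.

Fixpoint nmods (p : prog) : seq nat :=
  match p with
  | PN a _ _ => [:: a]
  | PSeq p q | PIf _ p q => nmods p ++ nmods q
  | PFor i _ p => i :: nmods p
  | _ => [::]
  end.

Fixpoint rmods (p : prog) : seq nat :=
  match p with
  | PR a _ _ => [:: a]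
  | PSeq p q | PIf _ p q => rmods p ++ rmods q
  | PFor _ _ p => rmods p
  | _ => [::]
  end.

(** Array 0 holds the loop bounds and must not be written; a loop body must also leave its own
    counter alone. These two conditions fix the number of rounds on entry. *)
Fixpoint wf (p : prog) : bool :=
  match p with
  | PN a _ _ => a != 0%N
  | PSeq p q | PIf _ p q => wf p && wf q
  | PFor i _ p => [&& i != 0%N, i \notin nmods p & wf p]
  | _ => true
  end.

(** Both branches of a conditional are charged, so the bound depends on the input parameters only.
    The constant 22 generously covers test and increment in each round, and a second time the
    initialisation with the final test. *)
Fixpoint tcost (g : nat -> nat) (p : prog) : nat :=
  match p with
  | PSkip => 1
  | PN _ i x => (ncost i + ncost x).+1
  | PR _ i x => (ncost i + rcost x).+1
  | PSeq p q => tcost g p + tcost g q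
  | PIf b p q => (bcost b + (tcost g p + tcost g q)).+1
  | PFor _ b p => bound_val g b * (tcost g p + 22) + 22
  end%N.

Definition upd (T : Type) (f : nat -> T) (i : nat) (v : T) : nat -> T :=
  fun j => if j == i then v else f j.

Lemma updE (T : Type) (f : nat -> T) i v j : upd f i v j = if j == i then v else f j.
Proof. by []. Qed.

Section Semantics.
Variable R : realFieldType.
Implicit Types (s : state R) (p : prog).

Definition setn s a i x := State (update (nmem s) a i x) (rmem s).
Definition setr s a i (x : R) := State (nmem s) (update (rmem s) a i x).
Definition incr i s := setn s i 0 (nmem s i 0).+1.

Fixpoint den p s : state R :=
  match p with
  | PSkip => s
  | PN a i x => setn s a (neval s i) (neval s x)
  | PR a i x => setr s a (neval s i) (reval s x)
  | PSeq p q => den q (den p s)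
  | PIf b p q => if beval s b then den p s else den q s
  | PFor i b p => iter (bound_val (nmem s 0%N) b) (fun s' => incr i (den p s')) (setn s i 0 0)
  end.

Lemma updateE (T : Type) (f : nat -> nat -> T) a i v b :
  update f a i v b = if b == a then upd (f a) i v else f b.
Proof. by rewrite /update /upd; case: eqP => [->|]. Qed.

Lemma nmem_setn s a i x b :
  nmem (setn s a i x) b = if b == a then upd (nmem s a) i x else nmem s b.
Proof. exact: updateE. Qed.

Lemma rmem_setn s a i x b : rmem (setn s a i x) b = rmem s b.
Proof. by []. Qed.

Lemma rmem_setr s a i x b :
  rmem (setr s a i x) b = if b == a then upd (rmem s a) i x else rmem s b.
Proof. exact: updateE. Qed.

Lemma nmem_setr s a i x b : nmem (setr s a i x) b = nmem s b.
Proof. by []. Qed.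

Lemma den_if b p q s : den (PIf b p q) s = if beval s b then den p s else den q s.
Proof. by []. Qed.

Lemma den_seq p q s : den (PSeq p q) s = den q (den p s).
Proof. by []. Qed.

Lemma den_n a i x s : den (PN a i x) s = setn s a (neval s i) (neval s x).
Proof. by []. Qed.

Lemma den_r a i x s : den (PR a i x) s = setr s a (neval s i) (reval s x).
Proof. by []. Qed.

Lemma den_skip s : den PSkip s = s.
Proof. by []. Qed.

Definition agree (ns rs : seq nat) s s' : Prop :=
  (forall a, a \notin ns -> nmem s' a = nmem s a) /\
  (forall a, a \notin rs -> rmem s' a = rmem s a).

Lemma agree_trans ns rs s1 s2 s3 :
  agree ns rs s1 s2 -> agree ns rs s2 s3 -> agree ns rs s1 s3.
Proof.
by move=> [n1 r1] [n2 r2]; split=> a ha; [rewrite n2 // n1|rewrite r2 // r1].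
Qed.

Lemma agree_sub ns rs ns' rs' s1 s2 : agree ns rs s1 s2 ->
  {subset ns <= ns'} -> {subset rs <= rs'} -> agree ns' rs' s1 s2.
Proof.
by move=> [n1 r1] hn hr; split=> a ha; [apply: n1|apply: r1]; apply: contraNN ha; [exact: hn|exact: hr].
Qed.

Lemma agree_den p s : agree (nmods p) (rmods p) s (den p s).
Proof.
elim: p s => [|a i x|a i x|p IHp q IHq|b p IHp q IHq|i b p IH] s //=.
- by split=> // c; rewrite inE => /negPf h; rewrite nmem_setn h.
- by split=> // c; rewrite inE => /negPf h; rewrite rmem_setr h.
- by apply: agree_trans (agree_sub (IHp s) _ _) (agree_sub (IHq _) _ _);
    move=> c; rewrite mem_cat => ->; rewrite ?orbT.
- by case: ifP => _; [apply: (agree_sub (IHp s))|apply: (agree_sub (IHq s))];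
    move=> c; rewrite mem_cat => ->; rewrite ?orbT.
have A s' x : agree (i :: nmods p) (rmods p) s' (setn s' i 0 x).
  by split=> // c; rewrite inE negb_or => /andP[/negPf h _]; rewrite nmem_setn h.
elim: (bound_val _ _) => [|j IHj] /=; first exact: A.
apply: agree_trans IHj (agree_trans _ (A _ _)).
by apply: (agree_sub (IH _)) => c //; rewrite inE => ->; rewrite orbT.
Qed.

Lemma nmem_den p s a : a \notin nmods p -> nmem (den p s) a = nmem s a.
Proof. by case: (agree_den p s) => H _; apply: H. Qed.

Lemma rmem_den p s a : a \notin rmods p -> rmem (den p s) a = rmem s a.
Proof. by case: (agree_den p s) => _; apply. Qed.

Lemma wf_nmods p : wf p -> 0%N \notin nmods p.
Proof.
elim: p => [|a i x|a i x|p IHp q IHq|b p IHp q IHq|i b p IH] //=.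
- by rewrite inE eq_sym.
- by move=> /andP[/IHp h1 /IHq h2]; rewrite mem_cat negb_or h1.
- by move=> /andP[/IHp h1 /IHq h2]; rewrite mem_cat negb_or h1.
- by move=> /and3P[i0 _ /IH h]; rewrite inE negb_or eq_sym i0.
Qed.

Lemma bound_expE s b : neval s (bound_exp b) = bound_val (nmem s 0%N) b.
Proof. by case: b. Qed.

Lemma exec_compile p s : wf p ->
  exists2 t, exec (compile p) s t (den p s) & (t <= tcost (nmem s 0%N) p)%N.
Proof.
elim: p s => [|a i x|a i x|p IHp q IHq|b p IHp q IHq|i b p IH] s /=.
- by exists 1%N => //; constructor.
- by exists (ncost i + ncost x).+1 => //; constructor.
- by exists (ncost i + rcost x).+1 => //; constructor.
- move=> /andP[wp wq]; have [t1 e1 l1] := IHp s wp; have [t2 e2 l2] := IHq (den p s) wq.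
  exists (t1 + t2)%N; first by econstructor; eassumption.
  by apply: leq_add => //; rewrite nmem_den ?wf_nmods in l2.
- move=> /andP[wp wq]; case: ifPn => hb.
    have [t e l] := IHp s wp; exists (bcost b + t).+1; first exact: ExecIfTrue.
    by rewrite ltnS leq_add2l (leq_trans l) // leq_addr.
  have [t e l] := IHq s wq; exists (bcost b + t).+1; first exact: ExecIfFalse.
  by rewrite ltnS leq_add2l (leq_trans l) // leq_addl.
move=> /and3P[i0 ip wp].
set g := nmem s 0%N; set v := bound_val g b.
set W := While _ _.
have loop k s1 j : nmem s1 0%N = g -> nmem s1 i 0 = j -> (j + k = v)%N ->
    exists2 t, exec W s1 t (iter k (fun s' => incr i (den p s')) s1) &
      (t <= k * (tcost g p + 22) + 14)%N.
  elim: k s1 j => [|k IHk] s1 j h0 hj hk.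
    eexists; first by apply: ExecWhileFalse; rewrite /= bound_expE h0 negbK; lia.
    by case: (b).
  have [t1 e1 l1] := IH s1 wp; rewrite h0 in l1.
  have d0 : nmem (den p s1) 0%N = g by rewrite nmem_den // wf_nmods.
  have dj : nmem (den p s1) i 0 = j by rewrite nmem_den.
  have [||t2 e2 l2] := IHk (incr i (den p s1)) j.+1 _ _ (etrans (addSnnS j k) hk).
  - by rewrite /incr nmem_setn eq_sym (negPf i0).
  - by rewrite /incr nmem_setn eqxx /upd eqxx dj.
  rewrite iterSr; eexists.
    apply: ExecWhileTrue e2; first by rewrite /= bound_expE h0 hj; lia.
    apply: (ExecSeq e1); rewrite /incr /setn -[X in update _ _ _ X]addn1.
    exact: (ExecNWrite i (NConst 0) (NAdd (NV i) (NConst 1))).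
  have : (bcost (BNot (BLeN (bound_exp b) (NV i))) <= 14)%N by case: (b).
  by move: l1 l2 => /=; rewrite mulSn; lia.
have [||t e l] := loop v (setn s i 0 0) 0%N _ _ (add0n _).
- by rewrite nmem_setn eq_sym (negPf i0).
- by rewrite nmem_setn eqxx.
eexists; first by apply: ExecSeq e; apply: ExecNWrite.
move: l => /=; lia.
Qed.

(** The invariant rule for counted loops. The [agree] premise of the step supplies the frame:
    everything that the loop does not write is as on entry and need not be part of [I]. *)
Lemma den_for (I : nat -> state R -> Prop) i b p s :
  wf (PFor i b p) ->
  (forall j s1 x, I j s1 -> I j (setn s1 i 0 x)) ->
  I 0%N s ->
  (forall j s1, (j < bound_val (nmem s 0%N) b)%N -> nmem s1 i 0 = j -> I j s1 ->
     agree (nmods (PFor i b p)) (rmods p) s s1 -> I j.+1 (den p s1)) ->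
  I (bound_val (nmem s 0%N) b) (den (PFor i b p) s).
Proof.
move=> /and3P[i0 ip wp] st I0 step /=; set v := bound_val _ _ in step *.
have A s' x : agree (i :: nmods p) (rmods p) s' (setn s' i 0 x).
  by split=> // c; rewrite inE negb_or => /andP[/negPf h _]; rewrite nmem_setn h.
suff H k : (k <= v)%N -> let s1 := iter k (fun s' => incr i (den p s')) (setn s i 0 0) in
    [/\ I k s1, nmem s1 i 0 = k & agree (i :: nmods p) (rmods p) s s1].
  by have [] := H v (leqnn v).
elim: k => [|k IHk] kv; first by split; [exact: st|rewrite nmem_setn eqxx|exact: A].
have [] := IHk (ltnW kv); rewrite iterS; set s1 := iter _ _ _ => I1 k1 a1.
split.
- by apply: st; apply: step.
- by rewrite /incr nmem_setn eqxx /upd eqxx nmem_den // k1.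
apply: agree_trans a1 (agree_trans _ (A _ _)).
by apply: (agree_sub (agree_den p s1)) => c //; rewrite inE => ->; rewrite orbT.
Qed.

End Semantics.

Definition denE := (den_if, den_seq, den_n, den_r, den_skip).
Global Opaque setn setr upd.
Arguments den : simpl never.

Definition nz x := BLeN (NConst 1) x.
Definition eqz x := BLeN x (NConst 0).
Definition bor a b := BNot (BAnd (BNot a) (BNot b)).
Definition bxor x y := bor (BAnd (nz x) (eqz y)) (BAnd (eqz x) (nz y)).
Definition ltR x y := BNot (BLeR y x).

Section Tests.
Variables (R : realFieldType) (s : state R).

Lemma beval_nz x : beval s (nz x) = (neval s x != 0%N).
Proof. by rewrite /= lt0n. Qed.

Lemma beval_eqz x : beval s (eqz x) = (neval s x == 0%N).
Proof. by rewrite /= leqn0. Qed.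

Lemma beval_bor a b : beval s (bor a b) = beval s a || beval s b.
Proof. by rewrite /= negb_and !negbK. Qed.

Lemma beval_bxor x y : beval s (bxor x y) = ((neval s x != 0%N) != (neval s y != 0%N)).
Proof.
rewrite /bxor beval_bor [beval _ (BAnd _ _)]/= [X in _ || X]/= !leqn0 !lt0n.
by do 2 case: eqP.
Qed.

Lemma beval_ltR x y : beval s (ltR x y) = (reval s x < reval s y).
Proof. by rewrite /= -ltNge. Qed.

Lemma beval_and a b : beval s (BAnd a b) = beval s a && beval s b.
Proof. by []. Qed.

Lemma beval_not a : beval s (BNot a) = ~~ beval s a.
Proof. by []. Qed.

End Tests.

Definition bevalE := (beval_nz, beval_eqz, beval_bor, beval_bxor, beval_ltR, beval_and, beval_not).
Global Opaque nz eqz bor bxor ltR.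

Definition support k (g : nat -> nat) : {set 'I_k} := [set x : 'I_k | g x != 0%N].

Lemma in_support k g (x : 'I_k) : (x \in support k g) = (g x != 0%N).
Proof. by rewrite inE. Qed.

Lemma support_upd k g (x : 'I_k) c :
  support k (upd g x c) = if c == 0%N then support k g :\ x else x |: support k g.
Proof.
apply/setP => y; rewrite in_support updE.
have -> : (y == x :> nat) = (y == x) by [].
by case: (c =P 0%N) => [->|/eqP c0]; rewrite !inE; case: (y == x).
Qed.

Definition memE := (nmem_setn, rmem_setn, nmem_setr, rmem_setr).

Section GraphMemory.
Variables (R : realFieldType) (n m : nat) (G : graph n m).

Record graph_mem (s : state R) : Prop := GraphMem {
  mem_n : nmem s 0 0 = n;
  mem_m : nmem s 0 1 = m;
  mem_src : forall e : 'I_m, nmem s 1 e = (G e).1;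
  mem_dst : forall e : 'I_m, nmem s 2 e = (G e).2 }.

Lemma graph_mem_agree ns rs s s' : agree ns rs s s' ->
  all (fun a => a \notin ns) [:: 0; 1; 2]%N -> graph_mem s -> graph_mem s'.
Proof.
case=> an _ /and4P[h0 h1 h2 _] [g1 g2 g3 g4]; split; rewrite ?an //.
Qed.

End GraphMemory.

Section Cuts.
Variables (n m : nat) (G : graph n m).
Implicit Types (A : {set 'I_n}) (X F : {set 'I_m}).
Notation cn X := (connect (adjacent G X)).
Notation src e := (G e).1.
Notation dst e := (G e).2.

Definition cutting A e := (src e \in A) != (dst e \in A).

Lemma uncut_connect A F u v : {in F, forall e, ~~ cutting A e} ->
  cn F u v -> (u \in A) = (v \in A).
Proof.
move=> H /connectP[q]; elim: q u => [|x q IH] u /=; first by move=> _ ->.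
case/andP => /existsP[e /andP[eF j]] pth /(IH _ pth) <-.
have /negPn/eqP E := H e eF.
by case: (joins_cases j) => [[-> ->]|[-> ->]].
Qed.

End Cuts.

(** * Minimum spanning trees and fundamental cuts *)

(* Memory layout. Integer arrays 0 to 2: input; 3 and 4: characteristic vectors of
   [X] and [Y]; 5 and 6: row [e] marks one side of the fundamental cut of [e] in
   [X] and in [Y]; 7: row offsets [e * n]; 8: vertices visited by Prim's algorithm;
   9 to 12, for each edge in the search: reached, explored, parent, type of the arc
   from the parent. Arrays from 20 on hold a number in cell 0: 20 to 23 are loop
   counters, 24 tells that the search is over, 25 is the current or selected edge,
   26 tells that an edge was selected, 27 is [#|Y :\: X|]. Scalar arrays 0 to 2:
   input; 3: worst-case costs; 4: [p]; 5: tentative distances; 6: current shift. *)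
Definition clear a := PFor 22 Verts (PN a (NV 22) (NConst 0)).

(** Serves both Prim's algorithm and the search. The flag in array 26 tells the absence of a
    candidate from the candidate with number 0. *)
Definition select b W := PFor 22 Edges
  (PIf (BAnd b (bor (eqz (NV 26)) (ltR (RRead W (NV 22)) (RRead W (NV 25)))))
    (PSeq (PN 25 (NConst 0) (NV 22)) (PN 26 (NConst 0) (NConst 1)))
    PSkip).

Definition prim_select W :=
  select (bxor (NRead 8 (NRead 1 (NV 22))) (NRead 8 (NRead 2 (NV 22)))) W.

Definition prim_round T W :=
  PSeq (PN 26 (NConst 0) (NConst 0))
  (PSeq (prim_select W)
    (PIf (nz (NV 26))
      (PSeq (PN T (NV 25) (NConst 1))
      (PSeq (PN 8 (NRead 1 (NV 25)) (NConst 1)) (PN 8 (NRead 2 (NV 25)) (NConst 1))))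
      PSkip)).

Definition prim T W :=
  PSeq (clear 8) (PSeq (PN 8 (NConst 0) (NConst 1)) (PFor 21 Verts (prim_round T W))).

Section Prim.
Variables (R : realFieldType) (n m : nat) (G : graph n m).
Implicit Types (A : {set 'I_n}) (F T : {set 'I_m}) (a : 'I_m -> R) (s : state R).
Notation cn X := (connect (adjacent G X)).
Notation src e := (G e).1.
Notation dst e := (G e).2.
Notation cutting := (cutting G).

(** The cut property. If [b] is not in [T], the tree path between its ends crosses the cut at some
    [g], which [b] replaces at no greater weight; [g] is not in [F], as no edge of [F] crosses the
    cut. *)
Lemma prim_step a A F T b : min_tree G a T -> F \subset T ->
  {in F, forall e, ~~ cutting A e} -> cutting A b ->
  (forall e, cutting A e -> a b <= a e) ->
  exists2 T', min_tree G a T' & b |: F \subset T'.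
Proof.
move=> [tT mT] sFT nF cb mb; case: (boolP (b \in T)) => bT.
  by exists T => //; rewrite subUset sub1set bT.
have [Z cZ pZ] := tree_path b tT.
have [g gZ cg] : exists2 g, g \in Z & cutting A g.
  apply/exists_inP; apply: contraLR cb; rewrite negb_exists_in => /forall_inP H.
  by rewrite negbK; apply/eqP; apply: uncut_connect cZ.
have [gT crg] := pZ g gZ; exists (b |: T :\ g); last first.
  rewrite setUS // subsetD1 sFT; apply/negP => /nF; by rewrite cg.
split=> [|T' tT']; first exact: swap.
by apply: le_trans (mT _ tT'); rewrite total_swap // -addrA gerDl addrC subr_le0 mb.
Qed.

Lemma den_clear (a : nat) s : a != 22%N -> a != 0%N ->
  nmem s 0 0 = n -> support n (nmem (den (clear a) s) a) = finset.set0.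
Proof.
move=> a22 a0 nE.
pose I j s1 := forall v, (v < j)%N -> nmem (R := R) s1 a v = 0%N.
have := @den_for R I 22 Verts (PN a (NV 22) (NConst 0)) s.
rewrite [bound_val _ _]/= nE => H; apply/setP => v; rewrite in_support inE H //.
- by rewrite /= inE eq_sym a22 a0.
- by move=> j s1 x h u /h; rewrite memE (negPf a22).
- move=> j s1 _ cnt h _ u; rewrite ltnS leq_eqVlt memE eqxx updE [neval _ _]cnt.
  by case: eqP => //= _; apply: h.
Qed.

Lemma den_select (P : pred 'I_m) b W s : nmem s 0 1 = m -> nmem s 26 0 = 0%N ->
  (forall s1 (e : 'I_m), agree [:: 22; 25; 26]%N [::] s s1 -> nmem s1 22 0 = e ->
     beval s1 b = P e) ->
  let a (e : 'I_m) := rmem s W e in let s' := den (select b W) s in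
  if nmem s' 26 0 == 0%N then forall e, ~~ P e
  else exists v : 'I_m, [/\ nmem s' 25 0 = v, P v & forall e, P e -> a v <= a e].
Proof.
move=> sm s0 bP a s'.
pose I j s1 := if nmem (R := R) s1 26 0 == 0%N then forall e : 'I_m, (e < j)%N -> ~~ P e
  else exists v : 'I_m, [/\ nmem s1 25 0 = v, P v &
         forall e : 'I_m, (e < j)%N -> P e -> a v <= a e].
have : I m s'; last first.
  rewrite /I; case: eqP => _; first by move=> H e; apply: H.
  by move=> [v [h1 h2 h3]]; exists v; split=> // e; apply: h3.
have := @den_for R I 22 Edges _ s; rewrite [bound_val _ _]/= sm; apply=> //.
- by rewrite /I s0.
move=> j s1 jm cnt; rewrite /I => h ag; pose e := Ordinal jm.
have EW : rmem s1 W = rmem s W by case: ag => _ ->.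
have be : beval s1 b = P e.
  by apply: bP => //; apply: (agree_sub ag) => // c; rewrite !inE.
rewrite !denE beval_and be !bevalE /= cnt EW -[j]/(nat_of_ord e).
have lt_cases (f : 'I_m) : (f < j.+1)%N -> f = e \/ (f < j)%N.
  by rewrite ltnS leq_eqVlt => /orP[/eqP h'|]; [left; apply: val_inj|right].
case ce : (P e) => /=; last first.
  case: eqP h => [z H|nz [v [h1 h2 h3]]].
    by move=> f /lt_cases[->|]; [rewrite ce|apply: H].
  by exists v; split=> // f /lt_cases[->|]; [rewrite ce|apply: h3].
case: eqP h => [z H|nz [v [h1 h2 h3]]] /=.
  rewrite !memE /= !updE /=; exists e; split=> // f /lt_cases[->|fj] cf //.
  by have := H f fj; rewrite cf.
rewrite h1; case: ltP => lt /=.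
  rewrite !memE /= !updE /=; exists e; split=> // f /lt_cases[->|fj] cf //.
  by apply: le_trans (ltW lt) (h3 f fj cf).
by case: eqP => // _; exists v; split=> // f /lt_cases[->|fj] cf //; apply: h3.
Qed.

Lemma den_prim_select W s : graph_mem G s -> nmem s 26 0 = 0%N ->
  let A := support n (nmem s 8) in let a (e : 'I_m) := rmem s W e in
  let s' := den (prim_select W) s in
  if nmem s' 26 0 == 0%N then forall e, ~~ cutting A e
  else exists b : 'I_m, [/\ nmem s' 25 0 = b, cutting A b & forall e, cutting A e -> a b <= a e].
Proof.
move=> gm s0 A; apply: den_select (mem_m gm) s0 _ => s1 e ag cnt.
have gm1 := graph_mem_agree ag isT gm.
have E8 : nmem s1 8 = nmem s 8 by case: ag => ->.
by rewrite !bevalE /= cnt (mem_src gm1) (mem_dst gm1) E8 -!in_support.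
Qed.

Lemma exists_min_tree a : connected_graph G -> exists T, min_tree G a T.
Proof.
move=> coG; pose con X := boolp.asbool (connected_by G X).
have [X mX _] : {X | minset con X & X \subset [set: 'I_m]%SET}.
  by apply: minset_exists; apply/boolp.asboolP.
have /boolp.asboolP cX := minsetp mX.
have tX : spanning_tree G X.
  apply/treeP; split=> // e eX; apply/negP => h.
  have /(minsetinf mX)/(_ (subsetDl _ _))/setP/(_ e) : con (X :\ e).
    by apply/boolp.asboolP => u v; move: (cX u v); rewrite -{1}(setD1K eX) cn_setU1_id.
  by rewrite !inE eqxx eX.
pose P T := boolp.asbool (spanning_tree G T).
have PX : P X by apply/boolp.asboolP.
have [T /boolp.asboolP tT mT] := arg_minP (total a) PX.
by exists T; split=> // T' tT'; apply: mT; apply/boolp.asboolP.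
Qed.

Lemma den_prim t W s : (0 < n)%N -> connected_graph G -> graph_mem G s ->
  all (fun b => t != b) [:: 0; 1; 2; 8; 21; 22; 25; 26]%N -> nmem s t = (fun=> 0%N) ->
  min_tree G (fun e : 'I_m => rmem s W e) (support m (nmem (den (prim t W) s) t)).
Proof.
move=> n0 coG gm /and5P[t0 t1 t2 t8 /and5P[t21 t22 t25 t26 _]] tz.
pose r := Ordinal n0; pose a (e : 'I_m) := rmem s W e.
(* A round either adds a vertex or finds no crossing edge and changes nothing. Hence the last
   clause, whose second alternative is impossible after [n] rounds. *)
pose J j s1 := let A := support n (nmem (R := R) s1 8) in let F := support m (nmem s1 t) in
  [/\ r \in A, {in A, forall v, cn F r v}, {in F, forall e, src e \in A /\ dst e \in A},
      exists2 T, min_tree G a T & F \subset T &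
      (forall e, ~~ cutting A e) \/ (j < #|A|)%N].
rewrite /prim !denE; set s1 := den (clear 8) s; set s2 := setn s1 8 _ _.
have ag1 : agree [:: 22; 8] [::] s s1 := agree_den (clear 8) s.
have ag2 : agree [:: 22; 8] [::] s s2.
  apply: agree_trans ag1 _; split=> // c; rewrite !inE negb_or => /andP[_ /negPf c8].
  by rewrite memE c8.
have gm2 := graph_mem_agree ag2 isT gm.
have A1 : support n (nmem s1 8) = finset.set0 by apply: den_clear (mem_n gm).
have ta : nmem s2 t = nmem s t by case: ag2 => ->; rewrite // !inE negb_or t22 t8.
have A2 : support n (nmem s2 8) = [set r]%SET.
  by rewrite memE /= (support_upd (nmem s1 8) r) A1 /= setU0.
have F2 : support m (nmem s2 t) = finset.set0 by apply/setP => e; rewrite in_support ta tz inE.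
have : J n (den (PFor 21 Verts (prim_round t W)) s2).
  have := @den_for R J 21 Verts (prim_round t W) s2; rewrite [bound_val _ _]/= (mem_n gm2); apply.
  - by rewrite /= !inE eq_sym [21%N == t]eq_sym (negPf t21) t0.
  - by move=> j s3 x; rewrite /J !memE /= (negPf t21).
  - rewrite /J A2 F2 cards1; split; try by [right].
    + by rewrite inE.
    + by move=> v; rewrite inE => /eqP ->; apply: connect0.
    + by move=> e; rewrite inE.
    + by have [T mT] := exists_min_tree a coG; exists T => //; apply: sub0set.
  move=> j s3 jn _ [rA AF FA [T mT sFT] prog] ag3.
  have gm3 : graph_mem G s3.
    by apply: graph_mem_agree ag3 _ gm2; rewrite /= !inE ![_ == t]eq_sym (negPf t0) (negPf t1) (negPf t2).
  have aW : rmem s3 W = rmem s W by case: ag3 => _ ->; rewrite //; case: ag2 => _ ->.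
  rewrite /prim_round !denE; set s4 := setn s3 26 _ _; set s5 := den _ s4.
  have ag4 : agree [:: 26] [::] s3 s4 by split=> // c; rewrite inE => /negPf c26; rewrite memE c26.
  have gm4 := graph_mem_agree ag4 isT gm3.
  have := @den_prim_select W _ gm4; rewrite /= -/s5 {1}/s4 memE /= updE => /(_ erefl).
  have ag5 : agree [:: 26; 22; 25] [::] s3 s5.
    by apply: agree_trans (agree_sub ag4 _ _) (agree_sub (agree_den _ s4) _ _) => // c; rewrite !inE;
      by case: (c == 26%N); case: (c == 22%N); case: (c == 25%N).
  have gm5 := graph_mem_agree ag5 isT gm3.
  have E8 : nmem s5 8 = nmem s3 8 by case: ag5 => ->.
  have Et : nmem s5 t = nmem s3 t.
    by case: ag5 => ->; rewrite // !inE (negPf t26) (negPf t22) (negPf t25).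
  have -> : nmem s4 8 = nmem s3 8 by case: ag4 => ->.
  rewrite !bevalE [neval _ _]/=; case: eqP => [_ closed|_ [b]] /=.
    by split; rewrite ?E8 ?Et //; [exists T|left].
  have -> : rmem s4 W = rmem s W by rewrite memE aW.
  rewrite -/a => -[bE cb mb].
  have nF : {in support m (nmem s3 t), forall e, ~~ cutting (support n (nmem s3 8)) e}.
    by move=> e /FA[h1 h2]; rewrite negbK h1 h2.
  have [T' mT' sT'] := prim_step mT sFT nF cb mb.
  have sb : nmem s5 1 b = src b := mem_src gm5 b.
  have db : nmem s5 2 b = dst b := mem_dst gm5 b.
  have ne c : t != c -> (c == t) = false by rewrite eq_sym => /negPf.
  rewrite /J !memE /= (ne 8%N) // (ne 1%N) // (ne 2%N) // (ne 25%N) // (negPf t8) eqxx bE sb db.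
  rewrite (support_upd _ (dst b)) (support_upd _ (src b)) (support_upd _ b) E8 Et /=.
  set A := support n (nmem s3 8) in rA AF FA cb mb nF prog *.
  set F := support m (nmem s3 t) in AF FA nF sFT sT' *.
  clearbody A F.
  split; last 1 first.
  - right; case: prog => [/(_ b)|lt]; first by rewrite cb.
    apply: leq_ltn_trans lt (proper_card _); rewrite properE; apply/andP; split.
      by apply/subsetP => v vA; rewrite !inE vA !orbT.
    apply/subsetPn; move: cb; rewrite /cutting.
    case: (boolP (src b \in A)) => [_ dA|sA _]; last by exists (src b); rewrite // !inE eqxx orbT.
    by exists (dst b); rewrite ?inE ?eqxx //; move: dA; case: (_ \in A).
  - by rewrite !inE rA !orbT.
  - have cnb : cn (b |: F) (src b) (dst b) by apply: cn_edge; rewrite setU11.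
    have AF' v : v \in A -> cn (b |: F) r v by move=> /AF; apply: cn_sub; apply: subsetUr.
    have [sR dR] : cn (b |: F) r (src b) /\ cn (b |: F) r (dst b).
      move: cb; rewrite /cutting; case: (boolP (src b \in A)) => [/AF' h _|_].
        by split=> //; apply: connect_trans h cnb.
      case: (boolP (dst b \in A)) => // /AF' h _; split=> //.
      by rewrite cn_sym in cnb; apply: connect_trans h cnb.
    by move=> v; rewrite !inE => /or3P[/eqP->|/eqP->|/AF'].
  - move=> e; rewrite !inE => /orP[/eqP->|/FA[h1 h2]]; first by rewrite !eqxx !orbT.
    by rewrite h1 h2 !orbT.
  - by exists T'.
case=> rA AF FA [T mT sFT] [closed|]; last by rewrite ltnNge (leq_trans (max_card _)) // card_ord.
have all_A v : v \in support n (nmem (den (PFor 21 Verts (prim_round t W)) s2) 8).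
  rewrite -(@uncut_connect _ _ G _ [set: 'I_m]%SET r v) //; exact: coG.
suff -> : support m (nmem (den (PFor 21 Verts (prim_round t W)) s2) t) = T by [].
apply: (tree_sub_eq (proj1 mT)) sFT.
move=> u v; apply: connect_trans (AF v (all_A v)); rewrite cn_sym; exact: AF.
Qed.

End Prim.

(** * Marking the fundamental cuts *)

Definition neqN x y := BNot (BAnd (BLeN x y) (BLeN y x)).

Lemma beval_neqN (R : realFieldType) (s : state R) x y :
  beval s (neqN x y) = (neval s x != neval s y).
Proof. by rewrite /= -eqn_leq. Qed.
Global Opaque neqN.

Definition row n (g : nat -> nat) (e : nat) : {set 'I_n} := [set v : 'I_n | g (e * n + v)%N != 0%N].

Lemma row_index_inj n e e' (v v' : 'I_n) : (e * n + v == e' * n + v')%N = (e == e') && (v == v').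
Proof.
have n0 : (0 < n)%N by case: n v v' => [[]|].
apply/eqP/andP => [E|[/eqP-> /eqP->]//].
have := congr1 (divn^~ n) E; have := congr1 (modn^~ n) E.
rewrite !modnMDl !modn_small // !divnMDl // !divn_small // !addn0 => /val_inj-> ->.
by rewrite !eqxx.
Qed.

Lemma in_row n g e (v : 'I_n) : (v \in row n g e) = (g (e * n + v)%N != 0%N).
Proof. by rewrite inE. Qed.

Lemma row_upd n g e (v : 'I_n) c e' :
  row n (upd g (e * n + v)%N c) e' =
  if e' == e then if c == 0%N then row n g e :\ v else v |: row n g e else row n g e'.
Proof.
apply/setP => u; rewrite in_row updE row_index_inj.
case: (eqVneq e' e) => [->|_] /=; last by rewrite in_row.
by case: (c =P 0%N) => [->|/eqP c0]; rewrite ?in_setD1 ?in_setU1 in_row; case: (u == v).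
Qed.

(** The machine cannot multiply, so the start of the row of the current edge is read from array 7,
    which [row_offsets] fills by repeated addition. *)
Definition off x := NAdd (NRead 7 (NV 22)) x.

Definition flood_clear M := PFor 23 Verts (PN M (off (NV 23)) (NConst 0)).

(** How far one sweep spreads the marks depends on the order of the edges, but it adds a vertex
    unless the marked set is closed, so [n] sweeps are enough. *)
Definition flood_round X M := PFor 23 Edges
  (PIf (BAnd (nz (NRead X (NV 23))) (BAnd (neqN (NV 23) (NV 22))
         (bxor (NRead M (off (NRead 1 (NV 23)))) (NRead M (off (NRead 2 (NV 23)))))))
    (PSeq (PN M (off (NRead 1 (NV 23))) (NConst 1)) (PN M (off (NRead 2 (NV 23))) (NConst 1)))
    PSkip).

Definition flood_row X M :=
  PSeq (flood_clear M)
  (PSeq (PN M (off (NRead 1 (NV 22))) (NConst 1)) (PFor 21 Verts (flood_round X M))).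

Definition flood X M := PFor 22 Edges (flood_row X M).

Section Flood.
Variables (R : realFieldType) (n m : nat) (G : graph n m).
Variables (X M : nat).
Hypothesis Mfresh : all (fun b => M != b) [:: 0; 1; 2; 7; 21; 22; 23; X]%N.
Hypothesis Xfresh : all (fun b => X != b) [:: 21; 22; 23]%N.
Implicit Types (s : state R).
Notation cn X := (connect (adjacent G X)).
Notation src e := (G e).1.
Notation dst e := (G e).2.
Notation cutting := (cutting G).

Definition offsets s := forall e : 'I_m, nmem s 7 e = (e * n)%N.

Lemma fresh_ne b : b \in [:: 0; 1; 2; 7; 21; 22; 23; X]%N -> (M == b) = false /\ (b == M) = false.
Proof. by move=> bs; have /negPf h : M != b := allP Mfresh b bs; rewrite h eq_sym h. Qed.

Lemma fresh_neX b : b \in [:: 21; 22; 23]%N -> (X == b) = false /\ (b == X) = false.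
Proof. by move=> bs; have /negPf h : X != b := allP Xfresh b bs; rewrite h eq_sym h. Qed.

Lemma graph_mem_flood ns s s' : agree [:: M; 21; 22; 23]%N ns s s' -> graph_mem G s -> offsets s ->
  [/\ graph_mem G s', offsets s', nmem s' X = nmem s X & nmem s' 7 = nmem s 7].
Proof.
move=> ag gm of_s.
have H b : b \in [:: 0; 1; 2; 7; X]%N -> nmem s' b = nmem s b.
  move=> bs; case: ag => ag _; apply: ag; rewrite !inE.
  have -> : (b == M) = false.
    by apply: (proj2 (fresh_ne _)); move: bs; rewrite !inE => /or4P[->|->|->|/orP[]->]; rewrite ?orbT.
  move: bs; rewrite !inE => /or4P[/eqP->|/eqP->|/eqP->|/orP[]/eqP->] //.
  by rewrite !(proj1 (fresh_neX _)) // !inE.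
have E7 : nmem s' 7 = nmem s 7 by apply: H.
split=> //; last by apply: H; rewrite !inE eqxx !orbT.
  by case: gm => *; split; rewrite ?H // !inE.
by move=> e; rewrite E7.
Qed.

Lemma den_flood_clear s (e : 'I_m) : graph_mem G s -> offsets s -> nmem s 22 0 = e ->
  let s' := den (flood_clear M) s in
  row n (nmem s' M) e = finset.set0 /\
  forall e', e' != e :> nat -> row n (nmem s' M) e' = row n (nmem s M) e'.
Proof.
move=> gm of_s e22.
have [M0 M7 M23] : [/\ M != 0, M != 7 & M != 23]%N by rewrite !(proj1 (fresh_ne _)) // !inE.
have [_ n7] := @fresh_ne 7 isT; have [_ n22] := @fresh_ne 22 isT; have [_ n23] := @fresh_ne 23 isT.
pose I j s1 := (forall v : 'I_n, (v < j)%N -> v \notin row n (nmem (R := R) s1 M) e) /\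
  forall e', e' != e :> nat -> row n (nmem s1 M) e' = row n (nmem s M) e'.
have := @den_for R I 23 Verts (PN M (off (NV 23)) (NConst 0)) s.
rewrite [bound_val _ _]/= (mem_n gm) => H.
have [||||H1 H2] := H.
- by rewrite /= inE n23 M0.
- by move=> j s1 x; rewrite /I memE (negPf M23).
- by split.
- move=> j s1 jn cnt [h1 h2] ag; pose v := Ordinal jn.
  have E b : b != 23%N -> b != M -> nmem s1 b = nmem s b.
    by move=> b1 b2; case: ag => -> //; rewrite !inE negb_or b1 b2.
  rewrite denE /= cnt !E ?n7 ?n22 // e22 of_s -[j]/(nat_of_ord v) /I memE eqxx.
  split=> [u|e' ne]; last by rewrite row_upd (negPf ne) h2.
  rewrite row_upd eqxx /= in_setD1; case: (eqVneq u v) => //= uv.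
  rewrite ltnS leq_eqVlt => /orP[/eqP uv'|/h1 //].
  by case/eqP: uv; apply: val_inj.
split=> //; apply/setP => v; rewrite [RHS]inE; apply: negPf; exact: H1.
Qed.

(** [K] is any set closed under [F] that contains the marks. Taken as the component sought, it
    bounds the growth; taken as the marked set itself, once that is closed, it shows that a further
    sweep changes nothing. *)
Lemma den_flood_round s (e : 'I_m) (K : {set 'I_n}) : graph_mem G s -> offsets s -> nmem s 22 0 = e ->
  let F := support m (nmem s X) :\ e in
  let A := row n (nmem s M) e in
  {in F, forall g, ~~ cutting K g} -> A \subset K ->
  let s' := den (flood_round X M) s in
  let A' := row n (nmem s' M) e in
  [/\ A \subset A', A' \subset K,
     forall e', e' != e :> nat -> row n (nmem s' M) e' = row n (nmem s M) e' &
     A' = A /\ {in F, forall g, ~~ cutting A g} \/ (#|A| < #|A'|)%N].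
Proof.
move=> gm of_s e22 F A FK AK.
have [M0 M7 M23] : [/\ M != 0, M != 7 & M != 23]%N by rewrite !(proj1 (fresh_ne _)) // !inE.
have [_ n7] := @fresh_ne 7 isT; have [_ n22] := @fresh_ne 22 isT; have [_ n23] := @fresh_ne 23 isT.
have [_ n1] := @fresh_ne 1 isT; have [_ n2] := @fresh_ne 2 isT.
pose I j s1 := let A' := row n (nmem (R := R) s1 M) e in
  [/\ A \subset A', A' \subset K,
     forall e', e' != e :> nat -> row n (nmem s1 M) e' = row n (nmem s M) e' &
     A' = A /\ {in F, forall g : 'I_m, (g < j)%N -> ~~ cutting A g} \/ (#|A| < #|A'|)%N].
have := @den_for R I 23 Edges _ s; rewrite [bound_val _ _]/= (mem_m gm) => H.
suff : I m (den (flood_round X M) s).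
  move=> [h1 h2 h3 h4]; split=> //; case: h4 => [[E h4]|]; [left|by right].
  by split=> // g gF; apply: h4.
apply: H => //.
- by rewrite /= !inE n23 M0.
- by move=> j s1 x; rewrite /I memE (negPf M23).
- by split=> //; left.
move=> j s1 jm cnt [h1 h2 h3 h4] ag; pose g := Ordinal jm.
have ag' : agree [:: M; 21; 22; 23]%N [::] s s1.
  by apply: (agree_sub ag) => // b; rewrite !inE; case: (b == 23%N); case: (b == M); rewrite ?orbT.
have [gm1 of1 EX E7] := graph_mem_flood ag' gm of_s.
have E22 : nmem s1 22 = nmem s 22 by case: ag => -> //; rewrite !inE n22.
rewrite !denE !(beval_neqN, bevalE) /= cnt E22 e22 EX -[j]/(nat_of_ord g).
rewrite (mem_src gm1) (mem_dst gm1) of1 -!in_row -in_support -[_ != _ :> bool]/(cutting _ g).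
have lt_cases (f : 'I_m) : (f < j.+1)%N -> f = g \/ (f < j)%N.
  by rewrite ltnS leq_eqVlt => /orP[/eqP h'|]; [left; apply: val_inj|right].
have -> : (g \in support m (nmem s X)) && ((g != e :> nat) && cutting (row n (nmem s1 M) e) g) =
   (g \in F) && cutting (row n (nmem s1 M) e) g.
  by rewrite /F in_setD1 andbA [X in X && _]andbC.
case: ifPn => [/andP[gF cg]|nc]; last first.
  split=> //; case: h4 => [[E h4]|]; [left|by right].
  split=> // f fF /lt_cases[fg|]; last exact: h4.
  by move: nc; rewrite E -fg fF.
rewrite /I /= !memE /= eqxx n7 n22 n23 n2 E22 e22 cnt -[j]/(nat_of_ord g) (mem_dst gm1) of1.
rewrite !(row_upd _ _ (dst g)) !(row_upd _ _ (src g)) eqxx /=.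
set B := row n (nmem s1 M) e in h1 h2 h4 cg *.
have [sK dK] : src g \in K /\ dst g \in K.
  have /negPn/eqP E := FK g gF; move: cg; rewrite /cutting.
  case: (boolP (src g \in B)) => [/(subsetP h2) h|_]; first by rewrite -E h.
  by case: (boolP (dst g \in B)) => // /(subsetP h2) h; rewrite E h.
split.
- by apply: subset_trans h1 _; apply/subsetP => v vB; rewrite !in_setU1 vB !orbT.
- by rewrite !subUset !sub1set sK dK.
- by move=> e' ne; rewrite !row_upd (negPf ne) h3.
right; apply: leq_ltn_trans (_ : #|B| < _)%N.
  by apply: subset_leq_card.
apply: proper_card; rewrite properE; apply/andP; split.
  by apply/subsetP => v vB; rewrite !in_setU1 vB !orbT.
apply/subsetPn; move: cg; rewrite /cutting.
case: (boolP (src g \in B)) => [_ dA|sA _]; last by exists (src g); rewrite // !in_setU1 eqxx orbT.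
by exists (dst g); rewrite ?in_setU1 ?eqxx //; move: dA; case: (_ \in B).
Qed.

Lemma den_flood_row s (e : 'I_m) : graph_mem G s -> offsets s -> nmem s 22 0 = e ->
  let s' := den (flood_row X M) s in
  row n (nmem s' M) e = [set v | cn (support m (nmem s X) :\ e) (src e) v]%SET /\
  forall e', e' != e :> nat -> row n (nmem s' M) e' = row n (nmem s M) e'.
Proof.
move=> gm of_s e22; set F := support m (nmem s X) :\ e.
set K := [set v | _]%SET.
have [M0 M7 M23] : [/\ M != 0, M != 7 & M != 23]%N by rewrite !(proj1 (fresh_ne _)) // !inE.
have [_ n7] := @fresh_ne 7 isT; have [_ n22] := @fresh_ne 22 isT; have [_ n21] := @fresh_ne 21 isT.
rewrite /flood_row !denE; set s1 := den (flood_clear M) s.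
have ag1 : agree [:: M; 21; 22; 23]%N [::] s s1.
  apply: (agree_sub (agree_den _ _)) => b //; rewrite !inE.
  by case: (b == 23%N); case: (b == M); rewrite ?orbT.
have [gm1 of1 X1 _] := graph_mem_flood ag1 gm of_s.
have s1_22 : nmem s1 22 0 = e.
  by rewrite /s1 nmem_den ?e22 // !inE n22.
have [r1 o1] := den_flood_clear gm of_s e22.
rewrite -/s1 /= in r1 o1; rewrite /= s1_22 of1 (mem_src gm1).
set s2 := setn s1 M _ _.
have ag2 : agree [:: M; 21; 22; 23]%N [::] s s2.
  apply: agree_trans ag1 _; split=> // b; rewrite inE negb_or => /andP[/negPf bM _].
  by rewrite memE bM.
have [gm2 of2 X2 _] := graph_mem_flood ag2 gm of_s.
have s2_22 : nmem s2 22 0 = e by rewrite memE n22.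
have nF : {in F, forall g, ~~ cutting K g}.
  move=> g gF; rewrite negbK !inE; apply/eqP.
  have h := cn_edge G gF; apply/idP/idP => h'; first exact: connect_trans h' h.
  by rewrite cn_sym in h; exact: connect_trans h' h.
pose J j s3 := let A := row n (nmem (R := R) s3 M) e in
  [/\ nmem s3 22 0 = e, src e \in A, A \subset K,
     forall e', e' != e :> nat -> row n (nmem s3 M) e' = row n (nmem s M) e' &
     {in F, forall g, ~~ cutting A g} \/ (j < #|A|)%N].
have := @den_for R J 21 Verts (flood_round X M) s2.
rewrite [bound_val _ _]/= (mem_n gm2) => H.
have [||||_ sA AK oA [closed|]] := H.
- by rewrite /= !inE n21 (proj2 (fresh_ne (b := 23%N) isT)) M0.
- move=> j s3 x; rewrite /J !memE /=.
  by have -> : (M == 21)%N = false by case: (fresh_ne (b := 21%N)).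
- rewrite /J s2_22 memE eqxx row_upd eqxx /= r1 setU0 set11 cards1; split=> //; last by right.
    by rewrite sub1set inE connect0.
  by move=> e' ne; rewrite row_upd (negPf ne) o1.
- move=> j s3 jn cnt [e3 sA AK oA prog] ag3.
  have ag3' : agree [:: M; 21; 22; 23]%N [::] s s3.
    apply: agree_trans ag2 _; apply: (agree_sub ag3) => // b; rewrite !inE.
    by case: (b == 23%N); case: (b == M); case: (b == 21%N); rewrite ?orbT.
  have [gm3 of3 X3 _] := graph_mem_flood ag3' gm of_s.
  have FE : support m (nmem s3 X) :\ e = F by rewrite X3.
  have step B := @den_flood_round s3 e B gm3 of3 e3.
  rewrite FE in step; have [h1 h2 h3 h4] := step K nF AK; split=> //.
  + by rewrite nmem_den // !inE n22.
  + exact: (subsetP h1).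
  + by move=> e' ne; rewrite h3 // oA.
  + case: h4 => [[-> h4]|h4]; first by left.
    case: prog => [cl|lt]; last by right; apply: leq_ltn_trans h4.
    have [_ h5 _ _] := step _ cl (subxx _).
    by move: h4; rewrite ltnNge subset_leq_card.
- split=> //; apply/eqP; rewrite eqEsubset AK; apply/subsetP => v; rewrite inE.
  by move=> /(uncut_connect closed) <-.
- by rewrite ltnNge (leq_trans (max_card _)) // card_ord.
Qed.

Lemma den_flood s : graph_mem G s -> offsets s ->
  forall e : 'I_m, row n (nmem (den (flood X M) s) M) e =
    [set v | cn (support m (nmem s X) :\ e) (src e) v]%SET.
Proof.
move=> gm of_s.
have [M0 M22] : [/\ M != 0 & M != 22]%N by rewrite !(proj1 (fresh_ne _)) // !inE.
have [_ n22] := @fresh_ne 22 isT.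
pose I j s1 := forall e : 'I_m, (e < j)%N -> row n (nmem (R := R) s1 M) e =
    [set v | cn (support m (nmem s X) :\ e) (src e) v]%SET.
have := @den_for R I 22 Edges (flood_row X M) s; rewrite [bound_val _ _]/= (mem_m gm) => H.
suff : I m (den (flood X M) s) by move=> h e; apply: h.
apply: H => //.
- by rewrite /= !inE n22 (proj2 (fresh_ne (b := 21%N) isT)) (proj2 (fresh_ne (b := 23%N) isT)) M0.
- by move=> j s1 x h; rewrite /I memE (negPf M22).
move=> j s1 jm cnt h ag; pose e := Ordinal jm.
have ag' : agree [:: M; 21; 22; 23]%N [::] s s1.
  apply: (agree_sub ag) => // b; rewrite !inE.
  by case: (b == 22%N); case: (b == 23%N); case: (b == M); case: (b == 21%N); rewrite ?orbT.
have [gm1 of1 X1 _] := graph_mem_flood ag' gm of_s.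
have [h1 h2] := @den_flood_row s1 e gm1 of1 cnt.
move=> f; rewrite ltnS leq_eqVlt; case: (eqVneq (f : nat) j) => [fj|fj] /=.
  by have -> : f = e; [apply: val_inj | rewrite h1 X1].
by move=> lt; rewrite h2 // h.
Qed.

End Flood.

(** * The algorithm *)

Definition seqs (ps : seq prog) : prog := foldr PSeq PSkip ps.

Definition rd a := NRead a (NV 22).

Definition grow_init := seqs
  [:: PFor 22 Edges (PSeq (PN 10 (NV 22) (NConst 0))
       (PIf (BAnd (nz (rd 4)) (eqz (rd 3)))
         (seqs [:: PN 9 (NV 22) (NConst 1); PR 5 (NV 22) RZero; PN 12 (NV 22) (NConst 2)])
         (PN 9 (NV 22) (NConst 0))));
      PN 24 (NConst 0) (NConst 0)].

(** Distances are stored as slacks for the current [p]. Raising [p] on the explored edges lowers the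
    slack of every arc that leaves them by the same amount, so one subtraction per unexplored edge
    keeps all labels correct. *)
Definition shift := PFor 22 Edges
  (PIf (nz (rd 10)) (PR 4 (NV 22) (RAdd (RRead 4 (NV 22)) (RV 6)))
                    (PR 5 (NV 22) (RSub (RRead 5 (NV 22)) (RV 6)))).

Definition arc_test t : bexp :=
  if t == 0%N then
    BAnd (nz (rd 3)) (BAnd (eqz (NRead 3 (NV 25)))
      (bxor (NRead 5 (NAdd (rd 7) (NRead 1 (NV 25)))) (NRead 5 (NAdd (rd 7) (NRead 2 (NV 25))))))
  else
    BAnd (nz (NRead 4 (NV 25))) (BAnd (eqz (rd 4))
      (bxor (NRead 6 (NAdd (NRead 7 (NV 25)) (rd 1))) (NRead 6 (NAdd (NRead 7 (NV 25)) (rd 2))))).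

Definition arc_slack t : rexp :=
  RAdd (RSub (RRead 4 (NV 22)) (RRead 4 (NV 25)))
       (if t == 0%N then RSub (RRead 0 (NV 25)) (RRead 0 (NV 22))
        else RSub (RRead 3 (NV 22)) (RRead 3 (NV 25))).

Definition relax_arc t :=
  PIf (BAnd (arc_test t) (bor (eqz (rd 9)) (ltR (arc_slack t) (RRead 5 (NV 22)))))
    (seqs [:: PR 5 (NV 22) (arc_slack t); PN 9 (NV 22) (NConst 1);
              PN 11 (NV 22) (NV 25); PN 12 (NV 22) (NConst t)])
    PSkip.

Definition relax_all := PFor 22 Edges
  (PIf (eqz (rd 10)) (PSeq (relax_arc 0) (relax_arc 1)) PSkip).

Definition grow_step := seqs
  [:: PN 26 (NConst 0) (NConst 0);
      select (BAnd (nz (rd 9)) (eqz (rd 10))) 5;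
      PR 6 (NConst 0) (RRead 5 (NV 25));
      shift;
      PN 10 (NV 25) (NConst 1);
      PIf (BAnd (nz (NRead 3 (NV 25))) (eqz (NRead 4 (NV 25))))
        (PN 24 (NConst 0) (NConst 1)) relax_all].

Definition grow := PFor 21 Edges (PIf (eqz (NV 24)) grow_step PSkip).

Section Grow.
Variables (R : realFieldType) (n m : nat) (G : graph n m).
Variables (X Y : {set 'I_m}) (C w : 'I_m -> R).
Implicit Types (s : state R) (p : 'I_m -> R) (Q : seq 'I_m).
Notation cn X := (connect (adjacent G X)).
Notation src e := (G e).1.
Notation dst e := (G e).2.

Record search_mem s : Prop := SearchMem {
  search_graph : graph_mem G s;
  search_offsets : offsets n m s;
  search_X : support m (nmem s 3) = X;
  search_Y : support m (nmem s 4) = Y;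
  search_cutX : forall e : 'I_m, row n (nmem s 5) e = [set v | cn (X :\ e) (src e) v]%SET;
  search_cutY : forall e : 'I_m, row n (nmem s 6) e = [set v | cn (Y :\ e) (src e) v]%SET;
  search_C : forall e : 'I_m, rmem s 0 e = C e;
  search_w : forall e : 'I_m, rmem s 3 e = w e }.

Lemma search_mem_agree ns rs s s' : agree ns rs s s' ->
  all (fun a => a \notin ns) [:: 0; 1; 2; 3; 4; 5; 6; 7]%N ->
  all (fun a => a \notin rs) [:: 0; 3]%N -> search_mem s -> search_mem s'.
Proof.
move=> ag /and5P[h0 h1 h2 h3 /and5P[h4 h5 h6 h7 _]] /and3P[r0 r3 _] [g o x y cx cy c3 c4].
have gm : graph_mem G s' by apply: graph_mem_agree ag _ g; rewrite /= h0 h1 h2.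
have [an ar] := ag.
by split=> //; rewrite ?an ?ar // => e; rewrite an ?ar //.
Qed.

Hypotheses (tX : spanning_tree G X) (tY : spanning_tree G Y).

Lemma beval_arc_test t s (v x : 'I_m) : search_mem s -> nmem s 22 0 = x -> nmem s 25 0 = v ->
  (t < 2)%N -> beval s (arc_test t) = arc G X Y t v x.
Proof.
move=> [gm of_s sX sY cX cY _ _] x22 v25; case: t => [|[|//]] _; rewrite !bevalE /= x22 v25.
  rewrite of_s (mem_src gm) (mem_dst gm) -!in_row -in_support sX.
  rewrite -[_ == 0%N]negbK -in_support sX /arc; case: (boolP (x \in X)) => //= xX.
  by rewrite cX !inE /crosses (cut_sides (src v) (dst v) tX xX).
rewrite of_s (mem_src gm) (mem_dst gm) -!in_row -in_support sY.
rewrite -[_ == 0%N]negbK -in_support sY /arc; case: (boolP (v \in Y)) => //= vY.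
by rewrite cY !inE /crosses (cut_sides (src x) (dst x) tY vY).
Qed.

Lemma reval_arc_slack t s (v x : 'I_m) : search_mem s -> nmem s 22 0 = x -> nmem s 25 0 = v ->
  reval s (arc_slack t) = slack C w (fun e => rmem s 4 e) t v x.
Proof.
by move=> [_ _ _ _ _ _ sC sw] x22 v25; rewrite /slack /=; case: t => [|t] /=;
  rewrite x22 v25 ?sC ?sw.
Qed.

(** [insubd] turns the parent cell into an edge; [par_bounded] ensures that its default value never
    occurs. *)
Definition status s (x : 'I_m) : bool * R * 'I_m * nat :=
  (nmem s 9 x != 0%N, rmem s 5 x, insubd x (nmem s 11 x), nmem s 12 x).

Lemma den_relax_arc t s (v x : 'I_m) : search_mem s -> nmem s 22 0 = x -> nmem s 25 0 = v ->
  (t < 2)%N ->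
  let s' := den (relax_arc t) s in
  [/\ status s' x = relax G X Y C w (fun e => rmem s 4 e) v t x (status s x),
      forall y, y != x -> status s' y = status s y &
      (forall y : 'I_m, (nmem s 11 y < m)%N) -> forall y : 'I_m, (nmem s' 11 y < m)%N].
Proof.
move=> se x22 v25 t2; rewrite /relax_arc !denE beval_and (beval_arc_test se x22 v25 t2) !bevalE.
rewrite (reval_arc_slack _ se x22 v25) /= x22 /relax {4}/status negbK.
case: ifP => _; last by split.
rewrite !memE /= x22 v25; split.
- by rewrite /status !memE /= !updE !eqxx valKd.
- move=> y yx; rewrite /status !memE /= !updE.
  by have -> : (y == x :> nat) = false by apply: negbTE.
- move=> H y; rewrite /= updE; case: eqP => // _; exact: ltn_ord.
Qed.

Definition pot s (e : 'I_m) : R := rmem s 4 e.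
Definition par_of s (x : 'I_m) : 'I_m := insubd x (nmem s 11 x).
Definition par_bounded s := forall y : 'I_m, (nmem s 11 y < m)%N.

Lemma ltS_cases j (jm : (j < m)%N) (f : 'I_m) : (f < j.+1)%N = (f == Ordinal jm) || (f < j)%N.
Proof. by rewrite ltnS leq_eqVlt. Qed.

Lemma den_relax_all s (v : 'I_m) : search_mem s -> nmem s 25 0 = v -> par_bounded s ->
  let s' := den relax_all s in
  par_bounded s' /\
  forall x : 'I_m, status s' x = if nmem s 10 x == 0%N then
      relax G X Y C w (pot s) v 1 x (relax G X Y C w (pot s) v 0 x (status s x)) else status s x.
Proof.
move=> se v25 pb.
pose I j s1 := par_bounded s1 /\
  forall x : 'I_m, status s1 x = if (x < j)%N && (nmem s 10 x == 0%N) then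
      relax G X Y C w (pot s) v 1 x (relax G X Y C w (pot s) v 0 x (status s x)) else status s x.
have := @den_for R I 22 Edges (PIf (eqz (rd 10)) (PSeq (relax_arc 0) (relax_arc 1)) PSkip) s.
rewrite [bound_val _ _]/= (mem_m (search_graph se)) => H.
have [||||h1 h2] := H => //.
  move=> j s1 jm cnt [b1 h] ag; pose y := Ordinal jm.
  have [an ar] := ag.
  have E10 : nmem s1 10 = nmem s 10 by rewrite an.
  have E4 : rmem s1 4 = rmem s 4 by rewrite ar.
  have se1 := search_mem_agree ag isT isT se.
  have v1 : nmem s1 25 0 = v by rewrite an.
  rewrite denE bevalE /= cnt E10 -[j]/(nat_of_ord y); case: ifP => z10; last first.
    by split=> // x; rewrite h ltS_cases -/y; case: (eqVneq x y) => //= ->; rewrite z10 !andbF.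
  rewrite denE; set s2 := den (relax_arc 0) s1.
  have [r1 r2 r3] := @den_relax_arc 0 s1 v y se1 cnt v1 isT.
  have ag2 : agree [:: 22; 9; 11; 12]%N [:: 5%N] s1 s2.
    by apply: (agree_sub (agree_den (relax_arc 0) s1)) => b; rewrite !inE;
      do ?[case: (b == _ :> nat) => //=].
  have [an2 ar2] := ag2.
  have se2 : search_mem s2 := search_mem_agree ag2 isT isT se1.
  have c2 : nmem s2 22 0 = y by rewrite /s2 nmem_den.
  have v2 : nmem s2 25 0 = v by rewrite an2.
  have p2 : rmem s2 4 = rmem s1 4 by rewrite ar2.
  have [q1 q2 q3] := @den_relax_arc 1 s2 v y se2 c2 v2 isT.
  split; first by apply: q3; apply: r3.
  move=> x; rewrite ltS_cases -/y; case: (eqVneq x y) => [->|xy] /=.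
    by rewrite z10 q1 r1 /pot p2 E4 h ltnn.
  by rewrite q2 // r2.
by split=> // x; rewrite h2 ltn_ord.
Qed.

Lemma den_shift s : nmem s 0 1 = m -> let s' := den shift s in
  forall x : 'I_m, (rmem s' 4 x = if nmem s 10 x != 0%N then rmem s 4 x + rmem s 6 0 else rmem s 4 x) /\
    (rmem s' 5 x = if nmem s 10 x != 0%N then rmem s 5 x else rmem s 5 x - rmem s 6 0).
Proof.
move=> sm.
pose I j s1 := forall x : 'I_m,
  (rmem (R := R) s1 4 x = if (x < j)%N && (nmem s 10 x != 0%N) then rmem s 4 x + rmem s 6 0 else rmem s 4 x) /\
    (rmem s1 5 x = if (x < j)%N && (nmem s 10 x == 0%N) then rmem s 5 x - rmem s 6 0 else rmem s 5 x).
have := @den_for R I 22 Edges (PIf (nz (rd 10)) (PR 4 (NV 22) (RAdd (RRead 4 (NV 22)) (RV 6)))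
                    (PR 5 (NV 22) (RSub (RRead 5 (NV 22)) (RV 6)))) s.
rewrite [bound_val _ _]/= sm => H.
have h : I m (den shift s).
  apply: H => // j s1 jm cnt h ag x; pose y := Ordinal jm.
  have E10 : nmem s1 10 = nmem s 10 by case: ag => ->.
  have E6 : rmem s1 6 = rmem s 6 by case: ag => _ ->.
  have [h4 h5] := h x; have [y4 y5] := h y.
  rewrite !denE bevalE /= cnt E10 E6 -[j]/(nat_of_ord y) ltS_cases -/y.
  case: (eqVneq x y) h4 h5 => [->|xy] h4 h5 /=.
    case: ifP => z10; rewrite !memE /= ?updE ?eqxx h4 h5 ltnn /=; split=> //.
      by move: z10; case: eqP.
    by move: z10; case: eqP.
  have xy' : (x == y :> nat) = false by apply: negbTE.
  by case: ifP => z10; rewrite !memE /= ?updE ?xy' h4 h5.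
by move=> s' x; have [-> ->] := h x; rewrite ltn_ord /=; case: eqP.
Qed.

Lemma den_grow_init s : search_mem s -> let s' := den grow_init s in
  nmem s' 24 0 = 0%N /\
  forall x : 'I_m, nmem s' 10 x = 0%N /\
    if x \in Y :\: X then [/\ nmem s' 9 x = 1%N, rmem s' 5 x = 0 & nmem s' 12 x = 2%N]
    else nmem s' 9 x = 0%N.
Proof.
move=> se; rewrite /grow_init /seqs /= !denE !memE eqxx updE eqxx; split=> //.
pose I j s1 := forall x : 'I_m, (x < j)%N -> nmem (R := R) s1 10 x = 0%N /\
    if x \in Y :\: X then [/\ nmem s1 9 x = 1%N, rmem s1 5 x = 0 & nmem s1 12 x = 2%N]
    else nmem s1 9 x = 0%N.
have H q := @den_for R I 22 Edges q s.
rewrite [bound_val _ _]/= (mem_m (search_graph se)) in H.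
suff h : I m (den (PFor 22 Edges (PSeq (PN 10 (NV 22) (NConst 0))
       (PIf (BAnd (nz (rd 4)) (eqz (rd 3)))
         (seqs [:: PN 9 (NV 22) (NConst 1); PR 5 (NV 22) RZero; PN 12 (NV 22) (NConst 2)])
         (PN 9 (NV 22) (NConst 0))))) s).
  by move=> x; have := h x (ltn_ord x).
apply: H => // j s1 jm cnt h ag x; pose y := Ordinal jm.
have se1 := search_mem_agree ag isT isT se.
rewrite /seqs !denE beval_and !bevalE /= !memE /= cnt -[j]/(nat_of_ord y) -[nmem _ 3 _ == _]negbK.
rewrite -!in_support (search_X se1) (search_Y se1) ltS_cases -/y.
have -> : (y \in Y) && (y \notin X) = (y \in Y :\: X) by rewrite inE andbC.
case: (eqVneq x y) => [->|xy] /= lt.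
  by case: ifP => sy; rewrite !memE /= !updE ?eqxx.
have xy' : (x == y :> nat) = false by apply: negbTE.
by have [h1 h2] := h x lt; case: ifP => sy; rewrite !memE /= !updE xy'.
Qed.

End Grow.

(** * Correctness of the search *)

Section Search.
Variables (R : realFieldType) (n m : nat) (G : graph n m).
Variables (X Y : {set 'I_m}) (C w : 'I_m -> R).
Implicit Types (s : state R) (p : 'I_m -> R) (Q : seq 'I_m).
Hypotheses (tX : spanning_tree G X) (tY : spanning_tree G Y).
Notation search_mem := (search_mem G X Y C w).

Definition frontier s j Q : Prop :=
  [/\ size Q = j, {in Q, forall x, x \notin X :\: Y} &
      forall x, x \notin Q -> tent G X Y C w (pot s) Q x (status s x)].

Definition finished s Q : Prop := exists Q0 t,
  [/\ Q = rcons Q0 t, t \in X :\: Y, nmem s 25 0 = t &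
      {in Q0, forall x, x \notin X :\: Y}].

Record explored s Q lam : Prop := Explored {
  explored_uniq : uniq Q;
  explored_mem : forall x : 'I_m, (x \in Q) = (nmem s 10 x != 0%N);
  explored_certificate : certificate G C w X Y (pot s) lam;
  explored_settled :
    {in Q, forall x : 'I_m, settled G X Y C w (pot s) Q (par_of s x) (nmem s 12 x) x};
  explored_bounded : par_bounded m s }.

(** There are two cases because the labels of unexplored edges are no longer maintained once a sink
    is reached. The clause [size Q = j] of [frontier] limits the number of rounds that reach
    none. *)
Definition search_inv j s : Prop := exists Q lam, explored s Q lam /\
  if nmem s 24 0 == 0%N then frontier s j Q else finished s Q.

Lemma den_grow_step s j f : search_mem s -> search_inv j s -> nmem s 24 0 = 0%N ->
  f \in Y :\: X -> search_inv j.+1 (den grow_step s).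
Proof.
move=> se [Q [lam [[uQ inQ ce st pb] fr]]] d0 fYX; move: fr; rewrite d0 eqxx => -[szQ ns te].
pose has (x : 'I_m) := nmem s 9 x != 0%N.
pose key (x : 'I_m) := rmem s 5 x.
pose ty (x : 'I_m) := nmem s 12 x.
have te' x : x \notin Q ->
    tentative G X Y C w (pot s) Q (has x) (key x) (par_of s x) (ty x) x := te x.
rewrite /grow_step /seqs; cbn [foldr]; rewrite 6!den_seq den_skip.
set s1 := den (PN 26 _ _) s; set s2 := den (select _ _) s1.
set s3 := den (PR 6 _ _) s2; set s4 := den shift s3; set s5 := den (PN 10 _ _) s4.
have [an2 ar2] : agree (nmods (PSeq (PN 26 (NConst 0) (NConst 0)) (select (BAnd (nz (rd 9)) (eqz (rd 10))) 5)))
  [::] s s2 := agree_den (PSeq (PN 26 (NConst 0) (NConst 0)) (select (BAnd (nz (rd 9)) (eqz (rd 10))) 5)) s.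
have se2 : search_mem s2 := search_mem_agree (conj an2 ar2) isT isT se.
have s1m : nmem s1 0 1 = m by rewrite /s1 den_n memE /= (mem_m (search_graph se)).
have s10 : nmem s1 26 0 = 0%N by rewrite /s1 den_n memE /= updE.
have s15 : rmem s1 5 = rmem s 5 by rewrite /s1 den_n memE.
have test s' (e : 'I_m) : agree [:: 22; 25; 26]%N [::] s1 s' -> nmem s' 22 0 = e ->
    beval s' (BAnd (nz (rd 9)) (eqz (rd 10))) = has e && (e \notin Q).
  move=> [an _] cnt; rewrite beval_and !bevalE /= cnt !an // /s1 den_n !memE /= /has.
  by rewrite inQ negbK.
have := @den_select R m (fun x => has x && (x \notin Q)) _ 5 s1 s1m s10 test.
rewrite /= -/s2 s15; case: eqP => _.
  move=> none; have [x xQ hx] := exists_tentative tX tY fYX ns te'.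
  by have := none x; rewrite hx xQ.
move=> [v [v25 /andP[hv vQ] mn]].
have mn' x : x \notin Q -> has x -> key v <= key x by move=> xQ hx; apply: mn; rewrite hx xQ.
have [an4 ar4] : agree [:: 26; 22; 25]%N [:: 6; 4; 5]%N s s4.
  have [an ar] := agree_den (PSeq (PR 6 (NConst 0) (RRead 5 (NV 25))) shift) s2.
  split=> b hb; [rewrite an ?an2 //|rewrite ar ?ar2 //]; move: hb; rewrite /= !inE !negb_or;
    by case/and3P => h1 h2 h3; rewrite ?h1 ?h2 ?h3.
have s36 : rmem s3 6 0 = key v by rewrite /s3 den_r memE /= updE /= v25 ar2.
have E3 b : b != 6%N -> rmem s3 b = rmem s b.
  by move=> b6; rewrite /s3 den_r memE (negPf b6) ar2.
have s3_10 : nmem s3 10 = nmem s 10 by rewrite /s3 den_r memE an2.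
have s3m : nmem s3 0 1 = m by rewrite /s3 den_r memE an2 // (mem_m (search_graph se)).
have sh := den_shift s3m; rewrite /= -/s4 s3_10 s36 !E3 // in sh.
have s4p : pot s4 = shifted (pot s) Q (key v).
  by apply: boolp.funext => x; rewrite /pot (proj1 (sh x)) /shifted inQ.
have s425 : nmem s4 25 0 = v.
  by rewrite -v25 /s4 nmem_den // /s3 den_r memE.
have [an5 ar5] : agree [:: 26; 22; 25; 10]%N [:: 6; 4; 5]%N s s5.
  rewrite /s5 den_n; split=> b hb; rewrite memE; last exact: ar4.
  move: hb; rewrite !inE !negb_or => /and4P[h1 h2 h3 h4].
  by rewrite (negPf h4) an4 // !inE !negb_or h1 h2 h3.
have s5p : pot s5 = shifted (pot s) Q (key v) by rewrite -s4p /pot /s5 den_n memE.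
have s525 : nmem s5 25 0 = v by rewrite /s5 den_n memE.
have se5 : search_mem s5 := search_mem_agree (conj an5 ar5) isT isT se.
have s5Q (x : 'I_m) : (x \in rcons Q v) = (nmem s5 10 x != 0%N).
  rewrite /s5 den_n memE /= updE s425 mem_rcons inE an4 // inQ.
  by have -> : (x == v :> nat) = (x == v) by []; case: eqP.
have s5st x : x \notin Q -> status s5 x = (has x, key x - key v, par_of s x, nmem s 12 x).
  move=> xQ; rewrite /status /par_of !an5 //; congr (_, _, _, _).
  by rewrite /s5 den_n memE (proj2 (sh x)) -inQ (negPf xQ).
have ce5 : certificate G C w X Y (pot s5) (lam + key v).
  by rewrite s5p; apply: (shift_certificate tX tY ce ns te' vQ hv mn').
have u5 : uniq (rcons Q v) by rewrite rcons_uniq vQ.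
have st5 : {in rcons Q v, forall x : 'I_m,
    settled G X Y C w (pot s5) (rcons Q v) (par_of s x) (nmem s 12 x) x}.
  by rewrite s5p; apply: (shift_settled ce st te' vQ hv).
rewrite den_if beval_and !bevalE [neval _ (NRead 3 _)]/= [neval _ (NRead 4 _)]/= s525.
rewrite -[nmem _ 4 _ == 0%N]negbK -!in_support (search_X se5) (search_Y se5).
have -> : (v \in X) && (v \notin Y) = (v \in X :\: Y) by rewrite inE andbC.
clearbody s5; exists (rcons Q v), (lam + key v); case: ifP => sink.
  split; last first.
    by rewrite den_n memE /= updE /=; exists Q, v; rewrite memE.
  split=> //.
  - move=> x xQ; rewrite den_n /par_of !memE /= !an5 // /pot memE; exact: st5.
  - by move=> x; rewrite den_n memE /= an5.
have pb5 : par_bounded m s5 by move=> x; rewrite an5.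
have [pb6 st6] := den_relax_all tX tY se5 s525 pb5.
have [an6 ar6] := agree_den relax_all s5.
have p6 : pot (den relax_all s5) = pot s5 by rewrite /pot ar6.
split; last first.
  rewrite an6 // an5 // d0 eqxx; split.
  - by rewrite size_rcons szQ.
  - by move=> x; rewrite mem_rcons inE => /orP[/eqP->|/ns//]; rewrite sink.
  move=> x; rewrite mem_rcons inE negb_or => /andP[xv xQ].
  have x0 : nmem s5 10 x == 0%N by rewrite -[_ == _]negbK -s5Q mem_rcons inE negb_or xv xQ.
  rewrite st6 x0 p6.
  apply: (relax_tentative (lam := lam + key v)) => //; rewrite s5st // s5p.
  apply: (@shift_tentative _ _ _ G X Y C w has (par_of s) ty (pot s) Q key) => //; last exact: te'.
  (* An unexplored source has distance 0, and [v] is nearest, so the shift vanishes as long as a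
     source is unexplored. *)
  move=> y sy yQ; case: (tentative_source (te' y yQ) sy) => hy _ ky.
  have k0 : 0 <= key v := key_ge0 ce (te' v vQ) hv.
  apply/eqP; rewrite eq_le k0 andbT; apply: le_trans (mn' y yQ hy) _.
  by rewrite ky.
split=> //; rewrite ?p6 //.
- by move=> x; rewrite an6 // s5Q.
- move=> x xQ.
  have x0 : (nmem s5 10 x == 0%N) = false by rewrite -[_ == _]negbK -s5Q xQ.
  have := st6 x; rewrite x0 => -[_ _ hp ht].
  rewrite /par_of hp ht !an5 //; exact: st5.
Qed.

Lemma search_inv_agree j s s' : agree [:: 21%N] [::] s s' -> search_inv j s -> search_inv j s'.
Proof.
move=> [an ar] [Q [lam [[uQ inQ ce st pb] fr]]]; exists Q, lam.
have pE : pot s' = pot s by rewrite /pot ar.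
have sE x : status s' x = status s x by rewrite /status !an ?ar.
split; first split=> //; rewrite ?pE //.
- by move=> x; rewrite an.
- by move=> x xQ; rewrite /par_of !an //; apply: st.
- by move=> x; rewrite an.
rewrite an //; case: eqP fr => _ [].
  by move=> h1 h2 h3; split=> // x xQ; rewrite sE pE; apply: h3.
by move=> Q0 [t [h1 h2 h3 h4]]; exists Q0, t; split=> //; rewrite an.
Qed.

Lemma den_grow s f : search_mem s -> search_inv 0 s -> f \in Y :\: X ->
  exists Q lam, explored (den grow s) Q lam /\ finished (den grow s) Q.
Proof.
move=> se si fYX.
have := @den_for R search_inv 21 Edges (PIf (eqz (NV 24)) grow_step PSkip) s.
rewrite [bound_val _ _]/= (mem_m (search_graph se)) => H.
have [||||Q [lam [ex fr]]] := H => //.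
- move=> j s1 x; apply: search_inv_agree.
  by split=> // a; rewrite inE memE => /negPf ->.
- move=> j s1 jm cnt si1 ag; rewrite den_if bevalE /=.
  have se1 := search_mem_agree ag isT isT se.
  case: eqP => d1; first exact: den_grow_step se1 si1 d1 fYX.
  have [Q [lam [ex fr]]] := si1; exists Q, lam; rewrite den_skip; split=> //.
  by move: fr; case: eqP.
(* If no sink were found, [m] distinct edges and hence all of them would be explored, including the
   sink that symmetric exchange provides for [f]. *)
exists Q, lam; split=> //; move: fr; case: eqP => // _ [szQ ns _].
have [fX fY] : f \notin X /\ f \in Y by move: fYX; rewrite inE => /andP[].
have [e [eX eY _ _]] := exchange tX tY fY fX.
have eQ : e \in Q.
  have sub : {subset Q <= enum 'I_m} by move=> x; rewrite mem_enum.
  have le : (size (enum 'I_m) <= size Q)%N by rewrite -cardE card_ord szQ.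
  by rewrite (uniq_min_size (explored_uniq ex) sub le) mem_enum.
by have := ns e eQ; rewrite inE eX eY.
Qed.

(** The search starts from the potential of the previous phase; only the labels are reset, and stale
    parents merely have to stay in range. *)
Lemma den_grow_init_inv s lam : search_mem s -> certificate G C w X Y (pot s) lam ->
  par_bounded m s -> search_inv 0 (den grow_init s).
Proof.
move=> se ce pb; have [d0 H] := den_grow_init se.
have [an ar] := agree_den grow_init s.
have pE : pot (den grow_init s) = pot s by rewrite /pot ar.
exists [::], lam; rewrite d0 eqxx; split.
  split=> //; rewrite ?pE //.
  - by move=> x; have [-> _] := H x.
  - by move=> x; rewrite an.
split=> // x _; rewrite pE /status; have [_] := H x.
case: ifP => sx; last first.
  by move=> ->; split=> //; rewrite sx.
by move=> [-> -> ->]; split=> //; rewrite sx.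
Qed.

End Search.

(** * A phase and the main program *)

Definition augment := PFor 21 Edges
  (PIf (neqN (NRead 12 (NV 25)) (NConst 2))
    (PSeq
      (PIf (eqz (NRead 12 (NV 25)))
        (PSeq (PN 3 (NV 25) (NConst 0)) (PN 3 (NRead 11 (NV 25)) (NConst 1)))
        (PSeq (PN 4 (NRead 11 (NV 25)) (NConst 0)) (PN 4 (NV 25) (NConst 1))))
      (PN 25 (NConst 0) (NRead 11 (NV 25))))
    PSkip).

Definition phase := seqs [:: flood 3 5; flood 4 6; grow_init; grow; augment].

Section Phase.
Variables (R : realFieldType) (n m : nat) (G : graph n m).
Implicit Types (s : state R).

Lemma den_augment s (t : 'I_m) : nmem s 0 1 = m -> par_bounded m s -> nmem s 25 0 = t ->
  let s' := den augment s in
  (support m (nmem s' 3), support m (nmem s' 4)) =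
  (iter m (flip (par_of s) (fun x : 'I_m => nmem s 12 x))
     (support m (nmem s 3), support m (nmem s 4), t)).1.
Proof.
move=> sm pb t25.
set fl := flip _ _; set st0 := (_, _, t).
pose I j s1 := exists v : 'I_m, nmem (R := R) s1 25 0 = v /\
  (support m (nmem s1 3), support m (nmem s1 4), v) = iter j fl st0.
have := @den_for R I 21 Edges _ s; rewrite [bound_val _ _]/= sm => H.
suff [v [_ <-]] : I m (den augment s) by [].
apply: H => //; first by exists t.
move=> j s1 jm _ [v [v25 st]] [an _]; rewrite /I iterS -st /fl /flip /=.
have E11 : nmem s1 11 = nmem s 11 by rewrite an.
have E12 : nmem s1 12 = nmem s 12 by rewrite an.
have pv : nmem s 11 v = par_of s v.
  by rewrite /par_of val_insubd pb.
rewrite den_if beval_neqN /= v25 E12; case: eqP => [_|_] /=; first by exists v.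
rewrite !denE !bevalE /= v25 E12; exists (par_of s v).
case: eqP => _; rewrite !memE /= ?memE /= v25 E11 pv updE; split=> //.
  by rewrite !support_upd.
by rewrite !support_upd.
Qed.

End Phase.

Definition row_offsets := PFor 22 Edges
  (PN 7 (NAdd (NV 22) (NConst 1)) (NAdd (NRead 7 (NV 22)) (NV 0))).

Definition worst_case := PFor 22 Edges (PR 3 (NV 22) (RAdd (RRead 1 (NV 22)) (RRead 2 (NV 22)))).

Definition count := PSeq (PN 27 (NConst 0) (NConst 0))
  (PFor 22 Edges (PIf (BAnd (nz (rd 4)) (eqz (rd 3)))
                     (PN 27 (NConst 0) (NAdd (NV 27) (NConst 1))) PSkip)).

Definition main_step := PSeq count
  (PIf (BNot (BLeN (NV 27) (NRead 0 (NConst 2)))) phase PSkip).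

Definition main := seqs [:: row_offsets; worst_case; prim 3 0; prim 4 3; PFor 20 Phases main_step].

Section Main.
Variables (R : realFieldType) (n m : nat) (G : graph n m).
Variables (C w : 'I_m -> R).
Implicit Types (s : state R).

Record base_mem s : Prop := BaseMem {
  base_graph : graph_mem G s;
  base_offsets : offsets n m s;
  base_bounded : par_bounded m s;
  base_C : forall e : 'I_m, rmem s 0 e = C e;
  base_w : forall e : 'I_m, rmem s 3 e = w e }.

Definition treeX s : {set 'I_m} := support m (nmem s 3).
Definition treeY s : {set 'I_m} := support m (nmem s 4).

Lemma den_phase s lam f : base_mem s ->
  certificate G C w (treeX s) (treeY s) (pot s) lam -> f \in treeY s :\: treeX s ->
  let s' := den phase s in
  [/\ base_mem s', #|treeY s :\: treeX s| = #|treeY s' :\: treeX s'|.+1 &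
      exists lam', certificate G C w (treeX s') (treeY s') (pot s') lam'].
Proof.
move=> [gm of_s pb sC sw] ce fYX.
have [[tX _] [tY _] _] := ce.
rewrite /phase /seqs; cbn [foldr]; rewrite !den_seq den_skip.
set s1 := den (flood 3 5) s; set s2 := den (flood 4 6) s1; set s3 := den grow_init s2.
set s4 := den grow s3.
have [an1 ar1] : agree (nmods (flood 3 5)) [::] s s1 := agree_den (flood 3 5) s.
have [an2 ar2] : agree (nmods (PSeq (flood 3 5) (flood 4 6))) [::] s s2 :=
  agree_den (PSeq (flood 3 5) (flood 4 6)) s.
have gm1 : graph_mem G s1 := graph_mem_agree (conj an1 ar1) isT gm.
have of1 : offsets n m s1 by move=> e; rewrite an1.
have fl1 := den_flood (X := 3) (M := 5) isT isT gm of_s.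
have fl2 := den_flood (X := 4) (M := 6) isT isT gm1 of1.
have se2 : search_mem G (treeX s) (treeY s) C w s2.
  split.
  - exact: graph_mem_agree (conj an2 ar2) isT gm.
  - by move=> e; rewrite an2.
  - by rewrite an2.
  - by rewrite an2.
  - by move=> e; rewrite /s2 nmem_den //; apply: fl1.
  - by move=> e; have := fl2 e; rewrite an1.
  - by move=> e; rewrite ar2.
  - by move=> e; rewrite ar2.
have p2 : pot s2 = pot s by rewrite /pot ar2.
have pb2 : par_bounded m s2 by move=> e; rewrite an2.
have ce2 : certificate G C w (treeX s) (treeY s) (pot s2) lam by rewrite p2.
have si3 := den_grow_init_inv se2 ce2 pb2; rewrite -/s3 in si3.
have se3 : search_mem G (treeX s) (treeY s) C w s3.
  exact: search_mem_agree (agree_den grow_init s2) isT isT se2.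
have [Q [lam' [ex fin]]] := den_grow tX tY se3 si3 fYX; rewrite -/s4 in ex fin.
have [uQ inQ ce4 st pb4] := ex; have [Q0 [t [QE sink t25 ns]]] := fin.
have se4 : search_mem G (treeX s) (treeY s) C w s4.
  exact: search_mem_agree (agree_den grow s3) isT isT se3.
have tQ : t \in Q by rewrite QE mem_rcons mem_head.
have only : {in Q, forall z, z \in treeX s :\: treeY s -> z = t}.
  by move=> z; rewrite QE mem_rcons inE => /orP[/eqP->//|/ns/negPf->].
have tQ0 : t \notin Q0 by move: uQ; rewrite QE rcons_uniq => /andP[].
have last : {in Q, forall z, (index z Q <= index t Q)%N}.
  by move=> z zQ; rewrite -ltnS {2}QE index_rcons_new // -(size_rcons Q0 t) -QE index_mem.
have szQ : (size Q <= m)%N by have := max_card (mem Q); rewrite card_ord (card_uniqP uQ).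
have [X' [Y' [r [E ce' card]]]] := certificate_augment st ce4 tQ sink only last szQ.
have := den_augment (mem_m (search_graph se4)) pb4 t25.
set s5 := den augment s4; rewrite (search_X se4) (search_Y se4) E => -[EX EY].
have [an5 ar5] := agree_den augment s4.
have [anp arp] : agree (nmods phase) (rmods phase) s s5 := agree_den phase s.
have p5 : pot s5 = pot s4 by rewrite /pot ar5.
split.
- split.
  + exact: graph_mem_agree (conj anp arp) isT gm.
  + by move=> e; rewrite anp.
  + by move=> e; rewrite an5.
  + by move=> e; rewrite arp.
  + by move=> e; rewrite arp.
- by rewrite card -EX -EY.
- by exists lam'; rewrite p5 /treeX /treeY EX EY.
Qed.

Lemma den_count s : graph_mem G s ->
  nmem (den count s) 27 0 = #|treeY s :\: treeX s|.
Proof.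
move=> gm; rewrite /count den_seq; set s1 := den (PN 27 _ _) s.
have s127 : nmem s1 27 0 = 0%N by rewrite /s1 den_n memE /= updE.
have [an ar] : agree [:: 27%N] [::] s s1 := agree_den (PN 27 (NConst 0) (NConst 0)) s.
pose D := treeY s :\: treeX s.
pose I j s2 := nmem (R := R) s2 27 0 = #|[set e in D | (e < j)%N]|%SET.
have := @den_for R I 22 Edges (PIf (BAnd (nz (rd 4)) (eqz (rd 3)))
                     (PN 27 (NConst 0) (NAdd (NV 27) (NConst 1))) PSkip) s1.
rewrite [bound_val _ _]/= an // (mem_m gm) /I => H; rewrite H //.
- by congr #|pred_of_set _|; apply/setP => e; rewrite inE ltn_ord andbT.
- by rewrite s127; apply/esym/eqP; rewrite cards_eq0; apply/eqP/setP => e; rewrite !inE ltn0 andbF.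
move=> j s2 jm cnt h [an2 _]; pose e := Ordinal jm.
rewrite !denE beval_and !bevalE /= cnt (an2 3%N) // (an2 4%N) // (an 3%N) // (an 4%N) // -[j]/(nat_of_ord e).
rewrite -[nmem _ 3 _ == 0%N]negbK -!in_support.
have -> : (e \in support m (nmem s 4)) && (e \notin support m (nmem s 3)) = (e \in D).
  by rewrite in_setD andbC.
clearbody D; have -> : [set f in D | (f < e.+1)%N]%SET =
    if e \in D then e |: [set f in D | (f < j)%N]%SET else [set f in D | (f < j)%N]%SET.
  apply/setP => f; case: ifP => eD; rewrite !inE ltS_cases -/e.
    by case: (eqVneq f e) => [->|] //=; rewrite eD.
  by case: (eqVneq f e) => [->|] //=; rewrite eD.
case: ifP => eD; last by rewrite h.
rewrite memE /= updE h addn1 cardsU1 inE eD /= ltnn.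
by rewrite add1n.
Qed.

Lemma den_row_offsets s : graph_mem G s -> nmem s 7 0 = 0%N -> offsets n m (den row_offsets s).
Proof.
move=> gm s7.
pose I j s1 := forall i, (i <= j)%N -> nmem (R := R) s1 7 i = (i * n)%N.
have := @den_for R I 22 Edges (PN 7 (NAdd (NV 22) (NConst 1)) (NAdd (NRead 7 (NV 22)) (NV 0))) s.
rewrite [bound_val _ _]/= (mem_m gm) => H.
have h : I m (den row_offsets s).
  apply: H => //; first by move=> i; rewrite leqn0 => /eqP->.
  move=> j s1 jm cnt h [an _] i; rewrite denE memE /= updE cnt (an 0%N) // (mem_n gm) h // addn1.
  by case: eqP => [-> _|ne le]; [rewrite mulSn addnC | apply: h; lia].
by move=> e; apply: h; apply: ltnW.
Qed.

Lemma den_worst_case s (e : 'I_m) : nmem s 0 1 = m ->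
  rmem (den worst_case s) 3 e = rmem s 1 e + rmem s 2 e.
Proof.
move=> sm.
pose I j s1 := forall f : 'I_m, (f < j)%N -> rmem (R := R) s1 3 f = rmem s 1 f + rmem s 2 f.
have := @den_for R I 22 Edges (PR 3 (NV 22) (RAdd (RRead 1 (NV 22)) (RRead 2 (NV 22)))) s.
rewrite [bound_val _ _]/= sm => H.
suff h : I m (den worst_case s) by apply: h.
apply: H => // j s1 jm cnt h [_ ar] f.
rewrite denE memE /= updE cnt (ar 1%N) // (ar 2%N) // ltnS leq_eqVlt.
by case: eqP => [->|_] //=; apply: h.
Qed.

Variable k : nat.

(** The second clause is the complementary slackness needed at the end: [lam] is 0 at the start, and
    a phase runs only above [k] and lowers the difference by exactly one. The third clause counts
    rounds, from at most [n.-1] down to [k]. *)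
Definition main_inv j s : Prop :=
  [/\ base_mem s, nmem s 0 2 = k & exists lam,
    [/\ certificate G C w (treeX s) (treeY s) (pot s) lam,
        lam = 0 \/ (k <= #|treeY s :\: treeX s|)%N &
        (#|treeY s :\: treeX s| <= k)%N \/ (#|treeY s :\: treeX s| + j <= n.-1)%N]].

Lemma base_mem_agree ns rs s s' : agree ns rs s s' ->
  all (fun a => a \notin ns) [:: 0; 1; 2; 7; 11]%N -> all (fun a => a \notin rs) [:: 0; 3]%N ->
  base_mem s -> base_mem s'.
Proof.
move=> ag /and5P[h0 h1 h2 h7 /andP[h11 _]] /and3P[r0 r3 _] [gm of_s pb sC sw].
have [an ar] := ag; split.
- by apply: graph_mem_agree ag _ gm; rewrite /= h0 h1 h2.
- by move=> e; rewrite an.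
- by move=> e; rewrite an.
- by move=> e; rewrite ar.
- by move=> e; rewrite ar.
Qed.

Lemma den_main_step j s : main_inv j s -> main_inv j.+1 (den main_step s).
Proof.
move=> [bm sk [lam [ce hl hD]]].
rewrite /main_step den_seq; set s1 := den count s.
have ag1 := agree_den count s; have [an ar] := ag1; rewrite -/s1 in an ar ag1.
have bm1 : base_mem s1 := base_mem_agree ag1 isT isT bm.
have E : [/\ treeX s1 = treeX s, treeY s1 = treeY s & pot s1 = pot s :> ('I_m -> R)].
  by split; rewrite /treeX /treeY /pot ?an ?ar.
have [EX EY Ep] := E.
rewrite den_if beval_not /= (den_count (base_graph bm)) an // sk -ltnNge.
case: ltnP => lt; last first.
  rewrite den_skip; split; rewrite ?an //; exists lam; rewrite EX EY Ep; split=> //.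
  by left.
have [f fD] : exists f, f \in treeY s :\: treeX s by apply/set0Pn; rewrite -card_gt0; lia.
rewrite -EX -EY -Ep in ce; rewrite -EX -EY in fD hl hD lt.
have [bm2 card [lam' ce']] := den_phase bm1 ce fD.
have [anp _] := agree_den phase s1.
split=> //; first by rewrite anp // an.
exists lam'; split=> //; first by right; lia.
by case: hD => hD; [left; lia | right; lia].
Qed.

End Main.

(** * Optimality of the output *)

Section Correctness.
Variables (R : realFieldType) (n m : nat) (G : graph n m) (k : nat).
Variables (C c d : 'I_m -> R).
Hypotheses (coG : connected_graph G) (kn : (k < n)%N) (d_ge0 : forall e, 0 <= d e).

Lemma tabulateE (T : Type) (x0 : T) (f : 'I_m -> T) (e : 'I_m) : tabulate x0 f e = f e.
Proof. by rewrite /tabulate valK. Qed.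

Lemma main_correct :
  rob_rec_ST_solution G k C (interval_scenarios c d)
    (output m (den main (input G k C c d))).
Proof.
set s0 := input G k C c d; pose w e := c e + d e.
have n0 : (0 < n)%N by apply: leq_ltn_trans kn.
rewrite /main /seqs; cbn [foldr]; rewrite 5!den_seq den_skip.
set s1 := den row_offsets s0; set s2 := den worst_case s1; set s3 := den (prim 3 0) s2.
set s4 := den (prim 4 3) s3.
have gm0 : graph_mem G s0 by split=> // e; rewrite /= tabulateE.
have [an1 ar1] : agree [:: 22; 7]%N [::] s0 s1 := agree_den row_offsets s0.
have [an2 ar2] : agree [:: 22; 7; 22]%N [:: 3]%N s0 s2 := agree_den (PSeq row_offsets worst_case) s0.
have ag3 := agree_den (PSeq row_offsets (PSeq worst_case (prim 3 0))) s0.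
have ag4 := agree_den (PSeq row_offsets (PSeq worst_case (PSeq (prim 3 0) (prim 4 3)))) s0.
have [an3 ar3] := ag3; have [an4 ar4] := ag4.
change (den _ s0) with s3 in ag3, an3, ar3; change (den _ s0) with s4 in ag4, an4, ar4.
have gm1 : graph_mem G s1 := graph_mem_agree (conj an1 ar1) isT gm0.
have gm2 : graph_mem G s2 := graph_mem_agree (conj an2 ar2) isT gm0.
have gm3 : graph_mem G s3 := graph_mem_agree ag3 isT gm0.
have gm4 : graph_mem G s4 := graph_mem_agree ag4 isT gm0.
have w2 (e : 'I_m) : rmem s2 3 e = w e.
  by rewrite /s2 den_worst_case ?(mem_m gm1) // !ar1 //= !tabulateE.
have C2 (e : 'I_m) : rmem s2 0 e = C e by rewrite ar2 //= tabulateE.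
have z3 : nmem s2 3 = (fun=> 0%N) by rewrite an2.
have z4 : nmem s3 4 = (fun=> 0%N) by rewrite an3.
have mX := den_prim (t := 3) 0 n0 coG gm2 isT z3.
have mY := den_prim (t := 4) 3 n0 coG gm3 isT z4.
have w3 (e : 'I_m) : rmem s3 3 e = w e.
  by rewrite -w2 /s3 rmem_den.
have inv4 : main_inv G C w k 0 s4.
  have of1 : offsets n m s1 by apply: (den_row_offsets gm0).
  split.
  - split=> //.
    + by move=> e; rewrite -of1 /s4 nmem_den // /s3 nmem_den // /s2 nmem_den.
    + by move=> e; rewrite an4 //=; apply: leq_ltn_trans (ltn_ord e).
    + by move=> e; rewrite ar4 //= tabulateE.
    + by move=> e; rewrite -w3 /s4 rmem_den.
  - by rewrite an4.
  have p4 : pot s4 = (fun=> 0) :> ('I_m -> R) by apply: boolp.funext => e; rewrite /pot ar4.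
  have tE : treeX m s4 = support m (nmem s3 3) by rewrite /treeX /s4 nmem_den.
  have ceX : min_tree G C (treeX m s4).
    by rewrite tE; move: mX; congr min_tree; apply: boolp.funext => e; rewrite C2.
  have ceY : min_tree G w (treeY m s4).
    by move: mY; congr min_tree; apply: boolp.funext => e; rewrite w3.
  (* With [p = 0] and [lam = 0] any two minimum spanning trees are certified. *)
  exists 0; rewrite p4; split; [split| by left|right].
  - by move: ceX; congr min_tree; apply: boolp.funext => e; rewrite subr0.
  - by move: ceY; congr min_tree; apply: boolp.funext => e; rewrite addr0.
  - by move=> e; rewrite lexx.
  rewrite addn0; have := card_tree_lt n0 (proj1 ceY).
  have : (#|treeY m s4 :\: treeX m s4| <= #|treeY m s4|)%N by apply: subset_leq_card; apply: subsetDl.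
  lia.
have := @den_for R (main_inv G C w k) 20 Phases main_step s4.
have -> : bound_val (nmem s4 0%N) Phases = (n - 1 - k)%N by rewrite an4.
case=> //.
- move=> j s x [bm sk ex].
  have ag : agree [:: 20%N] [::] s (setn s 20 0 x).
    by split=> // a; rewrite inE memE => /negPf ->.
  split; first exact: base_mem_agree ag isT isT bm.
    by rewrite memE.
  by move: ex; rewrite /treeX /treeY /pot !memE.
- by move=> j s _ _ + _; apply: den_main_step.
set s5 := den _ _ => bm sk [lam [ce hl hD]].
have [[tX _] [tY _] _] := ce.
(* Here [k < n] matters: it makes the truncated difference [n - 1 - k] exact, so that the counting
   clause leaves at most [k]. *)
have le : (#|treeY m s5 :\: treeX m s5| <= k)%N by case: hD => //; lia.
apply: (optimal_solution d_ge0 tX tY le) => X' Y' tX' tY' le'.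
apply: certificate_optimal ce _ tX' tY' le'.
by case: hl => [->|ge]; [left|right; apply/eqP; rewrite eqn_leq le ge].
Qed.

End Correctness.

(** * Running time *)

Fixpoint fits (a b c : nat) (p : prog) : bool :=
  match p with
  | PSeq p q | PIf _ p q => fits a b c p && fits a b c q
  | PFor _ Verts p => (0 < a)%N && fits a.-1 b c p
  | PFor _ Edges p => (0 < b)%N && fits a b.-1 c p
  | PFor _ Phases p => (0 < c)%N && fits a b c.-1 p
  | _ => true
  end.

(** The constant 44 is twice the 22 of [tcost]: the overhead of each round and that of the loop as a
    whole are both absorbed, as all factors of the bound are at least 1. *)
Fixpoint weight (p : prog) : nat :=
  match p with
  | PSkip => 1
  | PN _ i x => (ncost i + ncost x).+1
  | PR _ i x => (ncost i + rcost x).+1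
  | PSeq p q => weight p + weight q
  | PIf b p q => (bcost b + (weight p + weight q)).+1
  | PFor _ _ p => weight p + 44
  end%N.

(** [fits] bounds, for each kind of loop, how many are nested in one another, and these depths
    become the exponents. Rounding the bounds up to 1 makes the product monotone in the exponents,
    so shallower parts of the program fit under it too. *)
Lemma tcost_fits g x y z a b c p :
  (maxn 1 (g 0) <= x)%N -> (maxn 1 (g 1) <= y)%N -> (maxn 1 (g 0 - 1 - g 2) <= z)%N ->
  fits a b c p -> (tcost g p <= weight p * (x ^ a * y ^ b * z ^ c))%N.
Proof.
rewrite !geq_max => /andP[x0 gx] /andP[y0 gy] /andP[z0 gz].
have pos a' b' c' : (0 < x ^ a' * y ^ b' * z ^ c')%N by rewrite !muln_gt0 !expn_gt0 x0 y0 z0.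
have loop v u t W : (v <= u)%N -> (0 < u)%N -> (0 < W)%N -> forall t', (t' <= t * W)%N ->
    (v * (t' + 22) + 22 <= (t + 44) * (u * W))%N.
  move=> vu u0 W0 t' tt.
  have h1 : (v * (t' + 22) <= u * (t * W + 22 * W))%N.
    by rewrite leq_mul // leq_add // leq_pmulr.
  have h2 : (1 <= u * W)%N by rewrite muln_gt0 u0.
  nia.
elim: p a b c => [|? i e|? i e|p IHp q IHq|e p IHp q IHq|i [] p IH] a b c /=.
- by rewrite mul1n.
- by move=> _; rewrite leq_pmulr.
- by move=> _; rewrite leq_pmulr.
- by move=> /andP[/IHp h1 /IHq h2]; rewrite mulnDl leq_add.
- move=> /andP[/IHp h1 /IHq h2]; have W0 := pos a b c.
  have h3 := leq_pmulr (bcost e) W0.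
  by rewrite mulSn !mulnDl; lia.
- case: a => // a /IH h; rewrite expnS -!(mulnA x); exact: loop.
- case: b => // b /IH h; rewrite expnS [(x ^ a * _)%N]mulnCA -(mulnA y); exact: loop.
- case: c => // c /IH h; rewrite expnS [(x ^ a * y ^ b * (z * _))%N]mulnCA; exact: loop.
Qed.

Lemma connected_no_edge n (G : graph n 0) : connected_graph G -> (n <= 1)%N.
Proof.
move=> co; rewrite leqNgt; apply/negP => n1.
have /connectP[[|v q] /=] := co (Ordinal (ltnW n1)) (Ordinal n1).
  by move=> _ /(congr1 val).
by case/andP => /existsP[[]].
Qed.

Theorem theorem4 (R : realFieldType) :
  exists (p : cmd) (K : nat),
    forall (n m : nat) (G : graph n m) (k : nat) (C c d : 'I_m -> R),
      connected_graph G ->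
      (k < n)%N ->
      (forall e : 'I_m, 0 <= d e) ->
      exists (t : nat) (s : state R),
        [/\ exec p (input G k C c d) t s,
            (t <= K * time_bound n m k)%N
          & rob_rec_ST_solution G k C (interval_scenarios c d) (output m s)].
Proof.
exists (compile main), (weight main) => n m G k C c d coG kn d0.
have [t ex le] := @exec_compile R main (input G k C c d) isT.
exists t, (den main (input G k C c d)); split=> //; last exact: main_correct.
have n0 : (0 < n)%N by apply: leq_ltn_trans kn.
(* The deepest nest of loops is that of [flood] inside a phase: phases, edges, vertices, edges. *)
apply: leq_trans le (leq_trans (tcost_fits (leqnn _) (leqnn _) (leqnn _) (_ : fits 1 2 1 main)) _).
  by [].
rewrite leq_mul2l; apply/orP; right; rewrite /= /time_bound !expn1.
rewrite (maxn_idPr n0).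
(* Without edges a connected graph has a single vertex, and both bounds equal 1. Otherwise [m] is
   positive and its maximum with 1 disappears. *)
case: m G C c d coG {ex d0} => [|m] G C c d coG.
  by have := connected_no_edge coG; case: n n0 kn G coG => [|[|]] // _ kn _ _ _; lia.
rewrite [maxn 1 m.+1](maxn_idPr _) //; lia.
Qed.
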